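(* Let $H\in(0,\tfrac12)$ be known, $x_0,a,\sigma>0$, $T>0$, and let $X^H$ be the rough Bessel process, observed at the points $t_k=\frac{kT}{n}$, $k=0,\dots,n$. Then the estimator $$\widehat\sigma=\widehat\sigma_n:=\frac{1}{T^H}\sqrt{n^{-1+2H}\,V^n_{1,2}(X^H)}$$ is a (weakly) consistent estimator of the volatility coefficient $\sigma$, i.e. $\widehat\sigma_n\to\sigma$ in probability as $n\to\infty$.
   Context: $B^H=\{B^H(t),\ t\ge0\}$ is a fractional Brownian motion with Hurst index $H\in(0,\frac12)$: a centered Gaussian process with $\mathbb E[B^H(t)B^H(s)]=\frac12(t^{2H}+s^{2H}-|t-s|^{2H})$, always taken in its modification with paths locally Hölder continuous of every order $\lambda\in(0,H)$. For constants $x_0,a,\sigma>0$ and each $\varepsilon>0$, $X^H_\varepsilon$ is the unique pathwise solution of $$X^H_\varepsilon(t)=x_0+\int_0^t\frac{a}{X^H_\varepsilon(s)\mathbf 1_{\{X^H_\varepsilon(s)>0\}}+\varepsilon}\,ds+\sigma B^H(t),\qquad t\ge0.$$ For $\varepsilon_1<\varepsilon_2$ one has $X^H_{\varepsilon_1}(t)\ge X^H_{\varepsilon_2}(t)$ for all $t$, so the pointwise limit $X^H(t):=\lim_{\varepsilon\downarrow0}X^H_\varepsilon(t)$ exists; it is called the rough (fractional) Bessel process. With probability 1, $X^H(t)<\infty$ and $X^H(t)\ge0$ for all $t\ge0$, and $X^H(t)>0$ for almost all $t\ge0$. For a process $\xi$ on $[0,T]$ and $t_k=\frac{kT}{n}$,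 $V^n_{1,2}(\xi):=\sum_{k=0}^{n-1}(\xi(t_{k+1})-\xi(t_k))^2$. *)

(* Defs.v *)
From HB Require Import structures.
From mathcomp Require Export all_boot all_order all_algebra.
From mathcomp Require Export all_classical all_reals all_analysis.
Export Order.TTheory GRing.Theory Num.Theory.
Export numFieldNormedType.Exports.

Set Implicit Arguments.
Unset Strict Implicit.
Unset Printing Implicit Defensive.

Local Open Scope classical_set_scope.
Local Open Scope ring_scope.

(* Degenerate (zero variance) Gaussian laws are Dirac masses; they need a
   separate case because [normal_prob m 0] is the uniform law on [0, 1]. *)
Definition gaussian_law (R : realType) (mu : set R -> \bar R) : Prop :=
  exists m s : R, 0 <= s /\
    forall A : set R, measurable A ->
      mu A = if s == 0 then dirac m A else normal_prob m s A.

(* Processes are indexed by [R]; only the times [t >= 0] are meaningful. *)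
Definition gaussian_process (R : realType) (d : measure_display)
    (Omega : measurableType d) (P : probability Omega R)
    (B : R -> {RV P >-> R}) : Prop :=
  forall (n : nat) (t c : 'I_n -> R), (forall i, 0 <= t i) ->
    gaussian_law (pushforward P (fun w => \sum_(i < n) c i * B (t i) w)).

Definition hoelder_on (R : realType) (l : R) (A : set R) (f : R -> R) : Prop :=
  exists C : R, forall s t : R, A s -> A t ->
    `|f t - f s| <= C * `|t - s| `^ l.

Definition fractional_brownian_motion (R : realType) (d : measure_display)
    (Omega : measurableType d) (P : probability Omega R)
    (H : R) (B : R -> {RV P >-> R}) : Prop :=
  [/\ gaussian_process B,
      (forall t : R, 0 <= t -> ('E_P[B t] = 0)%E),
      (forall s t : R, 0 <= s -> 0 <= t ->
         ('E_P[fun w => (B t w * B s w)%R])%E =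
         (2^-1 * (t `^ (2 * H) + s `^ (2 * H) - `|t - s| `^ (2 * H)))%:E) &
      (forall (w : Omega) (l M : R), 0 < l < H -> 0 < M ->
         hoelder_on l `[0, M] (fun t => B t w))].

(* [x] solves, along the driving path [b], the integral equation with the drift
   regularized by [e]. *)
Definition regularized_solution (R : realType) (x0 a sigma e : R)
    (b x : R -> R) : Prop :=
  {within `[0, +oo[, continuous x} /\
  forall t : R, 0 <= t ->
    x t = x0
      + \int[lebesgue_measure]_(s in `[0, t]) (a / (x s * (0 < x s)%R%:R + e))
      + sigma * b t.

Definition rough_bessel (R : realType) (Omega : Type)
    (X : R -> R -> Omega -> R) (t : R) (w : Omega) : R :=
  lim (X e t w @[e --> 0^'+]).

Definition quadratic_variation (R : realType) (T : R) (n : nat)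
    (xi : R -> R) : R :=
  \sum_(0 <= k < n) (xi (k.+1%:R * T / n%:R) - xi (k%:R * T / n%:R)) ^+ 2.

Definition sigma_hat (R : realType) (Omega : Type) (H T : R)
    (X : R -> Omega -> R) (n : nat) (w : Omega) : R :=
  (T `^ H)^-1 *
  Num.sqrt (n%:R `^ (- 1 + 2 * H) * quadratic_variation T n (X ^~ w)).

(* Measurability is required because [P] is only meaningful on measurable
   sets. *)
Definition cvg_in_probability (R : realType) (d : measure_display)
    (Omega : measurableType d) (P : probability Omega R)
    (Y : nat -> Omega -> R) (Z : Omega -> R) : Prop :=
  [/\ (forall n, measurable_fun setT (Y n)),
      measurable_fun setT Z &
      forall delta : R, 0 < delta ->
        P [set w | delta <= `|Y n w - Z w|] @[n --> \oo] --> 0%E].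

(* Main.v *)
(* Write X = x0 + A + sigma B.  Since H < 1/2, paths of B are so rough that the
   drift A plays no role: each regularized drift is nondecreasing in time and
   bounded uniformly in epsilon (once X exceeds x0 its drift is at most a / x0),
   so A is finite and nondecreasing, the l2 norm of its increments is at most
   A(T), and the factor n^(-1/2+H) kills it.  By Minkowski, only
   n^(-1+2H) V(B) -> T^(2H) remains.  For a centered Gaussian pair
   E U^2 V^2 = E U^2 E V^2 + 2 (E U V)^2, and the increments of B are negatively
   correlated with telescoping covariances, so the variance of
   n^(-1+2H) V(B) is O(1/n) and Chebyshev's inequality applies.
   Measurability of X is obtained from Euler schemes, which converge to the
   regularized solutions. *)

(* The square root of the quadratic variation is a Euclidean norm, so the triangle inequality
   separates drift from noise path by path, whatever their dependence. The drift then contributes at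
   most a fixed random variable times a null sequence; instead of a moment, only the finiteness of
   that variable is exploited. [H < 1/2] enters twice: the null sequence is of order [n^(H - 1/2)],
   and concavity of [x^(2H)] fixes the sign of the correlations. Squared correlations at nonzero lag
   are at most their absolute values, which telescope along each row, so the n^2 terms of the
   variance add up to O(n). The joint law of two increments is accessible only through linear
   combinations. Each has fourth moment equal to three times its squared variance, and polarization
   turns this into the mixed moment, degenerate pairs included. The regularized solutions are given
   path by path, so their measurability in [w] has to be produced: an Euler scheme reads the noise
   at finitely many times only. *)
From HB Require Import structures.
Require Import Defs.
From mathcomp Require Import ring lra measurable_realfun charge.

Set Implicit Arguments.
Unset Strict Implicit.
Unset Printing Implicit Defensive.

Local Open Scope classical_set_scope.
Local Open Scope ring_scope.

(** * Moments of Gaussian laws *)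

Lemma integral_derive_vanish (R : realType) (G g : R -> R) (C : R) :
  (forall x : R, is_derive x 1 G (g x)) -> continuous g ->
  (@lebesgue_measure R).-integrable setT (EFin \o g) ->
  (forall x, `|x| * `|G x| <= C) ->
  (\int[lebesgue_measure]_x (g x)%:E = 0)%E.
Proof.
move=> dG cg ig GC.
(* On growing symmetric intervals the fundamental theorem leaves two boundary terms; the bound on
   [|x| * |G x|] makes each at most [C] over the half-length, and [|g|] dominates the
   truncations. *)
pose J (n : nat) : set R := [set` `[- (n.+1%:R : R), n.+1%:R]].
pose h (n : nat) : measurableTypeR R -> \bar R := (EFin \o g) \_ (J n).
have h_int n : (\int[lebesgue_measure]_x (h n x) = (G n.+1%:R - G (- n.+1%:R))%:E)%E.
  rewrite /h -integral_mkcond.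
  have nn : (- n.+1%:R < n.+1%:R :> R) by rewrite gtrN ?ltr0n.
  rewrite (continuous_FTC2 (F := G) nn) ?EFinB//.
  - exact: continuous_subspaceT.
  - have cG : continuous G.
      move=> x; apply: differentiable_continuous.
      apply/derivable1_diffP; exact: ex_derive.
    split => //.
    + by apply: cvg_at_right_filter; exact: cG.
    + by apply: cvg_at_left_filter; exact: cG.
  - by move=> x _; rewrite derive1E derive_val.
have C0 : 0 <= C by apply: le_trans (GC 0); rewrite normr0 mul0r.
have hcvg0 : (\int[lebesgue_measure]_x (h n x))%E @[n --> \oo] --> 0%E.
  under eq_fun do rewrite h_int.
  apply: cvg_EFin; first exact: nearW.
  apply/norm_cvg0P.
  apply: (@squeeze_cvgr _ _ _ _ (cst 0) (fun n => (C *+ 2) * @harmonic R n)).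
  - apply: nearW => n /=; rewrite normr_ge0/= /harmonic.
    rewrite ler_pdivlMr ?ltr0n//.
    apply: (le_trans (ler_wpM2r _ (ler_normB _ _))) => //.
    rewrite mulrDl mulr2n lerD// mulrC.
      by have := GC n.+1%:R; rewrite ger0_norm.
    by have := GC (- n.+1%:R); rewrite normrN ger0_norm.
  - exact: cvg_cst.
  - rewrite -[0](mulr0 (C *+ 2)); apply: cvgMr; exact: cvg_harmonic.
have mg := measurable_int _ ig.
have mh n : measurable_fun (setT : set (measurableTypeR R)) (h n).
  apply/(measurable_restrictT _ _).1; first exact: measurable_itv.
  exact: measurable_funTS mg.

have [|||_ _] := @dominated_convergence _ _ _ lebesgue_measure setT measurableT h
  (EFin \o g) (fun x => `|(EFin \o g) x|)%E mh mg.
- apply: aeW => x _; apply: cvg_near_cst.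
  exists (Num.trunc `|x|) => //=.
  move=> n; move=> /= xn.
  rewrite /h patchE mem_set// /J/= in_itv/=.
  rewrite -ler_norml (le_trans (ltW (truncnS_gt _)))//.
  by rewrite ler_nat ltnS.
- exact: integrable_abse.
- apply: aeW => x n _.
  rewrite /h patchE; case: ifPn => // _; by rewrite abse0 abse_ge0.
move=> hcvg.
exact: (cvg_unique _ hcvg hcvg0).
Qed.

(** Squaring [u / 2 <= expR (u / 2)] gives the constant 4. *)
Lemma sqr_expRN_le (R : realType) (u : R) : 0 <= u -> u ^+ 2 * expR (- u) <= 4.
Proof.
move=> u0; have e0 : 0 < expR (- u) by exact: expR_gt0.
have h : u / 2 <= expR (u / 2).
  by apply: le_trans (expR_ge1Dx _); rewrite lerDr.
have h2 : (u / 2) ^+ 2 <= expR u.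
  rewrite [u in expR u](_ : u = u / 2 + u / 2); last by field.
  by rewrite expRD expr2 ler_pM// divr_ge0.
have -> : u ^+ 2 = 4 * (u / 2) ^+ 2 by field.
rewrite -mulrA -[leRHS]mulr1 ler_wpM2l// expRN.
by rewrite ler_pdivrMr ?expR_gt0// mul1r.
Qed.

Section normal_moments.
Variables (R : realType) (m s : R).
Hypothesis s0 : 0 < s.
Local Notation phi := (normal_pdf m s).
Local Notation s2 := (Num.sqrt 2 * s).

Let sn0 : s != 0. Proof. by rewrite gt_eqF. Qed.

(** Half of the Gaussian exponent absorbs the polynomial factor; the other half is the density with
    doubled variance. Integrability and boundedness of all moments in use follow from this. *)
Lemma normal_pdf_widen : exists2 C, 0 <= C &
  forall x, (x - m) ^+ 4 * phi x <= C * normal_pdf m s2 x.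
Proof.
have s2n0 : s2 != 0 by rewrite mulf_neq0// gt_eqF// sqrtr_gt0.
(* With [u] as below, [(x - m)^4] is [16 s^4 u^2] and [u^2 expR (- u) <= 4], whence 64; the peaks
   correct the normalization. *)
exists (64 * s ^+ 4 * normal_peak s / normal_peak s2).
  rewrite mulr_ge0 ?invr_ge0 ?normal_peak_ge0// mulr_ge0 ?normal_peak_ge0//.
  by rewrite mulr_ge0// exprn_ge0// ltW.
move=> x; rewrite !normal_pdfE// [in leRHS]mulrA divfK; last first.
  by rewrite gt_eqF// normal_peak_gt0.
rewrite [leRHS](_ : _ = normal_peak s * (64 * s ^+ 4 * normal_fun m s2 x)); last by ring.
rewrite mulrCA ler_wpM2l ?normal_peak_ge0//.
pose u := (x - m) ^+ 2 / (4 * s ^+ 2).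
have u0 : 0 <= u by rewrite divr_ge0 ?sqr_ge0// mulr_ge0 ?sqr_ge0.
have -> : normal_fun m s2 x = expR (- u).
  rewrite /normal_fun /u; congr expR.
  by rewrite exprMn sqr_sqrtr//; field.
have -> : normal_fun m s x = expR (- u) * expR (- u).
  rewrite -expRD /normal_fun /u; congr expR; by field.
have -> : (x - m) ^+ 4 = 16 * s ^+ 4 * u ^+ 2 by rewrite /u; field.
rewrite [leLHS](_ : _ = 16 * s ^+ 4 * (u ^+ 2 * expR (- u)) * expR (- u)); last by ring.
rewrite ler_wpM2r ?expR_ge0//.
rewrite (_ : 64 * s ^+ 4 = 16 * s ^+ 4 * 4); last by ring.
by rewrite ler_wpM2l ?sqr_expRN_le// mulr_ge0 ?exprn_ge0// ltW.
Qed.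

Lemma normal_pow_le (k : nat) (x : R) : (k <= 4)%N ->
  `|(x - m) ^+ k * phi x| <= phi x + (x - m) ^+ 4 * phi x.
Proof.
move=> k4; have p0 := normal_pdf_ge0 m s x.
rewrite normrM (ger0_norm p0).
rewrite [leRHS](_ : _ = (1 + (x - m) ^+ 4) * phi x); last by ring.
rewrite ler_wpM2r//.
rewrite normrX.
have -> : (x - m) ^+ 4 = `|x - m| ^+ 4.
  by rewrite -normrX ger0_norm// (_ : 4 = 2 * 2)%N// exprM sqr_ge0.
have [x1|x1] := leP `|x - m| 1.
  by rewrite (le_trans (exprn_ile1 _ _ x1))// lerDl exprn_ge0.
by rewrite (le_trans (ler_weXn2l _ k4))// ?lerDr// ltW.
Qed.

Lemma integrable_normal_pow (k : nat) : (k <= 4)%N ->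
  (@lebesgue_measure R).-integrable setT (fun x => ((x - m) ^+ k * phi x)%:E).
Proof.
move=> k4; have [C C0 hC] := normal_pdf_widen.
apply: (@le_integrable _ (measurableTypeR R) _ lebesgue_measure setT measurableT _
  (fun x => (phi x + C * normal_pdf m s2 x)%:E)).
- apply/measurable_EFinP; apply: measurable_funM => //.
    by apply: measurable_funX; exact: measurable_funB.
  exact: measurable_normal_pdf.
- move=> x _; rewrite /= lee_fin.
  apply: (le_trans (normal_pow_le x k4)).
  by rewrite (le_trans _ (ler_norm _))// lerD2l.
- rewrite (_ : (fun _ => _) = (fun x => (phi x)%:E + (C%:E * (normal_pdf m s2 x)%:E))%E)//.
  apply: integrableD => //; first exact: integrable_normal_pdf.
  by apply: integrableZl => //; exact: integrable_normal_pdf.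
Qed.

Lemma is_derive_normal_pow (k : nat) (x : R) :
  is_derive x 1 (fun x => (x - m) ^+ k * phi x)
    (k%:R * ((x - m) ^+ k.-1 * phi x) - s ^- 2 * ((x - m) ^+ k.+1 * phi x)).
Proof.
have db (y : R) : is_derive y 1 (fun x => x - m) 1.
  by apply: is_derive_eq; rewrite subr0.
have dX j : is_derive x 1 (fun x => (x - m) ^+ j) (j%:R * (x - m) ^+ j.-1).
  rewrite (_ : (fun _ => _) = (fun x => x - m) ^+ j); last first.
    by apply/funext => y; rewrite exprfctE.
  by apply: is_derive_eq; rewrite scaler1 /= mulr_natl.
have dphi : is_derive x 1 phi (- s ^- 2 * ((x - m) * phi x)).
  rewrite normal_pdfE// /normal_fun.
  have -> : (fun x => normal_peak s * expR (- (x - m) ^+ 2 / (s ^+ 2 *+ 2))) =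
     normal_peak s *: (expR \o ((- (s ^+ 2 *+ 2)^-1) *: (fun x => (x - m) ^+ 2))).
    apply/funext => y; rewrite !fctE; congr (_ * expR _).
    by rewrite /GRing.scale/= !mulNr mulrC.
  apply: is_derive_eq.
  rewrite !fctE /GRing.scale/= -mulr_natr.
  have -> : - (s ^+ 2 * 2)^-1 * (x - m) ^+ 2 = - (x - m) ^+ 2 / (s ^+ 2 * 2).
    by rewrite !mulNr mulrC.
  by field.
apply: (@is_derive_eq _ _ _ ((fun x => (x - m) ^+ k) * phi)).
rewrite /GRing.scale/= (exprS _ k).
move: ((x - m) ^+ k.-1) ((x - m) ^+ k) (phi x) (s ^- 2) => u v w z.
by ring.
Qed.


Local Notation M k := (\int[lebesgue_measure]_x ((x - m) ^+ k * phi x)%:E)%E.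

Lemma continuous_normal_pow k : continuous (fun x => (x - m) ^+ k * phi x).
Proof.
move=> x; apply: differentiable_continuous; apply/derivable1_diffP.
by have h := is_derive_normal_pow k x; exact: ex_derive.
Qed.

(** The factor [|x|] costs one more power of [x - m], and domination reaches the fourth power: hence
    [k <= 3]. *)
Lemma normal_pow_bound (k : nat) : (k <= 3)%N ->
  exists C, forall x, `|x| * `|(x - m) ^+ k * phi x| <= C.
Proof.
move=> k3; have [C C0 hC] := normal_pdf_widen.
have bnd j x : (j <= 4)%N ->
    `|(x - m) ^+ j * phi x| <= normal_peak s + C * normal_peak s2.
  move=> j4; apply: (le_trans (normal_pow_le x j4)).
  apply: lerD; first exact: normal_pdf_ub.
  apply: (le_trans (hC x)); rewrite ler_wpM2l// normal_pdf_ub//.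
  by rewrite mulf_neq0// gt_eqF// sqrtr_gt0.
exists ((1 + `|m|) * (normal_peak s + C * normal_peak s2)) => x.
have xm : `|x| <= `|x - m| + `|m| by rewrite -{1}(subrK m x) ler_normD.
apply: (le_trans (ler_wpM2r _ xm)) => //.
rewrite mulrDl [leRHS]mulrDl mul1r lerD//.
  by rewrite -normrM mulrA -exprS bnd.
by rewrite ler_wpM2l// bnd// (leq_trans k3).
Qed.

(* integrate the derivative of [(x - m) ^+ k * phi x]; for [k = 0] the junk
   predecessor on the right is killed by the factor [k] *)
Lemma normal_pow_rec (k : nat) : (k <= 3)%N ->
  ((s ^- 2)%:E * M k.+1 = k%:R%:E * M k.-1)%E.
Proof.
move=> k3; have [C hC] := normal_pow_bound k3.
have k4 : (k.-1 <= 4)%N by rewrite (leq_trans (leq_pred _))// (leq_trans k3).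
have i1 : (@lebesgue_measure R).-integrable setT
    (fun x => (k%:R * ((x - m) ^+ k.-1 * phi x))%:E).
  by apply: (integrableZl measurableT k%:R (integrable_normal_pow k4)).
have i2 : (@lebesgue_measure R).-integrable setT
    (fun x => (s ^- 2 * ((x - m) ^+ k.+1 * phi x))%:E).
  by apply: (integrableZl measurableT (s ^- 2) (integrable_normal_pow (_ : k.+1 <= 4)%N)).
have cg : continuous (fun x => k%:R * ((x - m) ^+ k.-1 * phi x) -
    s ^- 2 * ((x - m) ^+ k.+1 * phi x)).
  move=> x; apply: cvgB; apply: cvgMr; exact: continuous_normal_pow.
have ig : (@lebesgue_measure R).-integrable setT
    (EFin \o (fun x => k%:R * ((x - m) ^+ k.-1 * phi x) - s ^- 2 * ((x - m) ^+ k.+1 * phi x))).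
  exact: (integrableB measurableT i1 i2).
have := integral_derive_vanish (is_derive_normal_pow k) cg ig hC.
under eq_integral do rewrite EFinB.
rewrite integralB//.
rewrite -!integralZl//; last 2 first.
- exact: integrable_normal_pow.
- exact: integrable_normal_pow.
under [in X in _ -> X = _]eq_integral do rewrite -EFinM.
under [in X in _ -> _ = X]eq_integral do rewrite -EFinM.
move: (integrable_fin_num measurableT i1) (integrable_fin_num measurableT i2) => /= f1 f2 h.
move: f1 f2 h; case: integral => // a _; case: integral => // b _.
by move=> -[] /eqP; rewrite subr_eq0 => /eqP ->.
Qed.

Lemma normal_moments : [/\ M 1 = 0, M 2 = (s ^+ 2)%:E & M 4 = (3 * s ^+ 4)%:E]%E.
Proof.
have sV k : ((s ^+ 2)%:E * ((s ^- 2)%:E * M k) = M k)%E.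
  by rewrite muleA -EFinM divff ?mul1e// expf_neq0.
have M0 : M 0 = 1%E.
  by under eq_integral do rewrite expr0 mul1r; exact: integral_normal_pdf.
have M2 : M 2 = (s ^+ 2)%:E by rewrite -(sV 2) (@normal_pow_rec 1)// M0 !mule1.
split => //.
  by rewrite -(sV 1) (@normal_pow_rec 0)// mul0e mule0.
rewrite -(sV 4) (@normal_pow_rec 3)//= M2 -!EFinM; congr EFin; ring.
Qed.

End normal_moments.

Section normal_integral.
Variables (R : realType) (m s : R).
Local Notation mu := (@lebesgue_measure R).

(** The Radon-Nikodym derivative of [normal_prob] agrees almost everywhere with [normal_pdf], since
    both have the same integral over every measurable set. *)
Lemma ge0_integral_normal_prob (f : R -> \bar R) :
  measurable_fun [set: measurableTypeR R] f -> (forall x, 0 <= f x)%E ->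
  (\int[normal_prob m s]_x f x = \int[mu]_x (f x * (normal_pdf m s x)%:E))%E.
Proof.
move=> mf f0.
have dom := @normal_prob_dominates R m s.
rewrite -(Radon_Nikodym_SigmaFinite.change_of_variables dom)//=.
apply: ae_eq_integral => //.
- apply: emeasurable_funM => //.
  apply: (measurable_int mu).
  exact: Radon_Nikodym_SigmaFinite.f_integrable.
- apply: emeasurable_funM => //=.
  apply/measurableT_comp => //=; exact: measurable_normal_pdf.
- apply: ae_eqe_mul2l => /=.
  apply: integral_ae_eq => //=.
  + exact: Radon_Nikodym_SigmaFinite.f_integrable.
  + by apply/measurableT_comp =>//; exact: measurable_normal_pdf.
  + by move=> E E01 mE; rewrite -Radon_Nikodym_SigmaFinite.f_integral.
Qed.

Lemma integral_normal_prob (f : R -> \bar R) :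
  (normal_prob m s).-integrable [set: measurableTypeR R] f ->
  (\int[normal_prob m s]_x f x = \int[mu]_x (f x * (normal_pdf m s x)%:E))%E.
Proof.
move=> fi.
have dom := @normal_prob_dominates R m s.
rewrite -(Radon_Nikodym_change_of_variables dom)//=.
apply: ae_eq_integral => //.
- by apply: emeasurable_funM => //; exact: measurable_int fi.
- apply: emeasurable_funM; first exact: measurable_int fi.
  by apply/measurableT_comp => //=; exact: measurable_normal_pdf.
- apply: ae_eqe_mul2l => /=.
  rewrite Radon_NikodymE//=.
  case: cid => /= h [h1 h2 h3].
  apply: integral_ae_eq => //=.
  + by apply/measurableT_comp =>//; exact: measurable_normal_pdf.
  + move=> E E01 mE; rewrite -h3//=.
Qed.
End normal_integral.

Section gaussian_law_moments.
Variables (R : realType) (d : measure_display) (Omega : measurableType d).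
Variable P : probability Omega R.
Implicit Types (Z : {RV P >-> R}) (m s : R) (f : R -> R).

Definition has_law Z m s := forall A : set R, measurable A ->
  pushforward P Z A = if s == 0 then dirac m A else normal_prob m s A.

(* [normal_prob] is a measure for the structure [measurableTypeR R], while random
   variables take values in [R] with its default measurable structure: these two
   lemmas push [P] forward to the former. *)
Lemma ge0_gaussian_integral Z m s f : 0 <= s -> has_law Z m s ->
  measurable_fun setT f -> (forall x, 0 <= f x) ->
  (\int[P]_w (f (Z w))%:E)%E = if s == 0 then (f m)%:E else
    (\int[lebesgue_measure]_x (f x * normal_pdf m s x)%:E)%E.
Proof.
move=> s_ge0 law mf f0.
have mfE : measurable_fun [set: measurableTypeR R] (EFin \o f) by exact/measurable_EFinP.
have mZ : measurable_fun setT (Z : Omega -> measurableTypeR R).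
  by have := @measurable_funPT _ _ _ _ Z.
have := @ge0_integral_pushforward _ _ _ _ R _ mZ P setT _ measurableT mfE.
rewrite preimage_setT => <-; last by move=> y _; rewrite lee_fin.
case: ifPn => s0.
  rewrite (eq_measure_integral (\d_ (m : measurableTypeR R)))//.
    by rewrite integral_dirac// diracT mul1e.
  by move=> A mA _; have := law A mA; rewrite s0.
rewrite (@eq_measure_integral _ _ _ _ (normal_prob m s)).
  rewrite ge0_integral_normal_prob//.
by move=> A mA _; have := law A mA; rewrite (negbTE s0).
Qed.

Lemma gaussian_integral Z m s f : 0 <= s -> has_law Z m s ->
  measurable_fun setT f -> P.-integrable setT (fun w => (f (Z w))%:E) ->
  (\int[P]_w (f (Z w))%:E)%E = if s == 0 then (f m)%:E else
    (\int[lebesgue_measure]_x (f x * normal_pdf m s x)%:E)%E.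
Proof.
move=> s_ge0 law mf fi.
have mfE : measurable_fun [set: measurableTypeR R] (EFin \o f) by exact/measurable_EFinP.
have mZ : measurable_fun setT (Z : Omega -> measurableTypeR R).
  by have := @measurable_funPT _ _ _ _ Z.
have := @integral_pushforward _ _ _ _ R _ mZ P setT _ mfE fi measurableT.
rewrite preimage_setT => <-.
case: ifPn => s0.
  rewrite (eq_measure_integral (\d_ (m : measurableTypeR R)))//.
    by rewrite integral_dirac// diracT mul1e.
  by move=> A mA _; have := law A mA; rewrite s0.
have law' A : measurable A ->
    pushforward P (Z : Omega -> measurableTypeR R) A = normal_prob m s A.
  by move=> mA; have := law A mA; rewrite (negbTE s0).
rewrite (@eq_measure_integral _ _ _ _ (normal_prob m s)).
  rewrite integral_normal_prob//.
  - apply/integrableP; split => //.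
    rewrite (@eq_measure_integral _ _ _ _ (pushforward P (Z : Omega -> measurableTypeR R))).
      by have /integrableP[] :=
        @integrable_pushforward _ _ _ _ R _ mZ P setT _ mfE fi measurableT.
    by move=> A mA _; apply/esym/law'.
by move=> A mA _; exact: law'.
Qed.

Lemma integrable_pow_le4 (Y : Omega -> R) (k : nat) : (k <= 4)%N ->
  measurable_fun setT Y ->
  P.-integrable setT (fun w => (Y w ^+ 4)%:E) ->
  P.-integrable setT (fun w => (Y w ^+ k)%:E).
Proof.
move=> k4 mY iY.
apply: (@le_integrable _ _ _ _ _ measurableT _ (fun w => (1 + Y w ^+ 4)%:E)).
- by apply/measurable_EFinP; exact: measurable_funX.
- move=> w _; rewrite /= lee_fin.
  apply: le_trans (ler_norm _); rewrite normrX.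
  have -> : Y w ^+ 4 = `|Y w| ^+ 4.
    by rewrite -normrX ger0_norm// (_ : 4 = 2 * 2)%N// exprM sqr_ge0.
  have [x1|x1] := leP `|Y w| 1.
    by rewrite (le_trans (exprn_ile1 _ _ x1))// lerDl exprn_ge0.
  by rewrite (le_trans (ler_weXn2l _ k4))// ?lerDr// ltW.
- under eq_fun do rewrite EFinD.
  apply: integrableD => //; exact: finite_measure_integrable_cst.
Qed.

Lemma gaussian_moments Z m s : 0 <= s -> has_law Z m s ->
  [/\ P.-integrable setT (fun w => ((Z w - m) ^+ 4)%:E),
      (\int[P]_w (Z w - m)%:E = 0)%E,
      (\int[P]_w ((Z w - m) ^+ 2)%:E = (s ^+ 2)%:E)%E &
      (\int[P]_w ((Z w - m) ^+ 4)%:E = (3 * s ^+ 4)%:E)%E].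
Proof.
move=> s_ge0 law.
have mf k : measurable_fun setT (fun x : R => (x - m) ^+ k).
  by apply: measurable_funX; exact: measurable_funB.
have p4 x : 0 <= (x - m) ^+ 4 by rewrite (_ : 4 = 2 * 2)%N// exprM sqr_ge0.
have mZ : measurable_fun setT (fun w => Z w - m) by exact: measurable_funB.
have I4 : (\int[P]_w ((Z w - m) ^+ 4)%:E = (3 * s ^+ 4)%:E)%E.
  rewrite (@ge0_gaussian_integral _ m s (fun x => (x - m) ^+ 4))//.
  case: ifPn => [/eqP ->|s0]; first by rewrite subrr !expr0n/= mulr0.
  have s_gt0 : 0 < s by rewrite lt_neqAle eq_sym s0.
  by have [] := normal_moments m s_gt0.
have i4 : P.-integrable setT (fun w => ((Z w - m) ^+ 4)%:E).
  apply/integrableP; split; first by apply/measurable_EFinP; exact: measurable_funX.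
  under eq_integral do rewrite /= ger0_norm//.
  by rewrite I4 ltry.
have i1 : P.-integrable setT (fun w => ((Z w - m) ^+ 1)%:E) by exact: integrable_pow_le4.
split => //.
- rewrite (@gaussian_integral _ m s (fun x => (x - m) ^+ 1))//.
  case: ifPn => [_|s0]; first by rewrite subrr.
  have s_gt0 : 0 < s by rewrite lt_neqAle eq_sym s0.
  by have [] := normal_moments m s_gt0.
- rewrite (@ge0_gaussian_integral _ m s (fun x => (x - m) ^+ 2))//; last first.
    by move=> x; exact: sqr_ge0.
  case: ifPn => [/eqP ->|s0]; first by rewrite subrr !expr0n/=.
  have s_gt0 : 0 < s by rewrite lt_neqAle eq_sym s0.
  by have [] := normal_moments m s_gt0.
Qed.

(** Integrability stands outside the centering condition, because translating that condition into a
    real-valued integral already relies on it. *)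
Lemma gaussian_centered Z : gaussian_law (pushforward P Z) ->
  P.-integrable setT (fun w => (Z w ^+ 4)%:E) /\
  ((\int[P]_w (Z w)%:E = 0)%E ->
   exists v : R, (\int[P]_w (Z w ^+ 2)%:E = v%:E)%E /\
                 (\int[P]_w (Z w ^+ 4)%:E = (3 * v ^+ 2)%:E)%E).
Proof.
move=> [m [s [s_ge0 law]]].
have [i4 I1 I2 I4] := gaussian_moments s_ge0 law.
have mZ : measurable_fun setT (fun w => Z w - m) by exact: measurable_funB.
have i1 : P.-integrable setT (fun w => (Z w - m)%:E) := @integrable_pow_le4 _ 1 isT mZ i4.
split.
  apply: (@le_integrable _ _ _ _ _ measurableT _
    (fun w => (8 * ((Z w - m) ^+ 4 + m ^+ 4))%:E)).
  - by apply/measurable_EFinP; exact: measurable_funX.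
  - move=> w _; rewrite /= lee_fin; apply: le_trans (ler_norm _).
    rewrite ger0_norm; last by rewrite (_ : 4 = 2 * 2)%N// exprM sqr_ge0.
    move: (Z w) => z.
    have -> : z = (z - m) + m by rewrite subrK.
    rewrite addrK; move: (z - m) => y.
    (* [(y + m)^4 <= 8 (y^4 + m^4)] is convexity of the fourth power; the gap factors into visibly
       nonnegative terms. *)
    rewrite -subr_ge0 [leRHS](_ : _ =
      (y - m) ^+ 2 * (5 * (y + m) ^+ 2 + 2 * y ^+ 2 + 2 * m ^+ 2)); last by ring.
    by rewrite mulr_ge0 ?sqr_ge0// !addr_ge0// mulr_ge0 ?sqr_ge0.
  - rewrite (_ : (fun _ => _) =
        (fun w => 8%:E * (((Z w - m) ^+ 4)%:E + (m ^+ 4)%:E))%E); last first.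
      by apply/funext => w; rewrite EFinM EFinD.
    apply: integrableZl => //; apply: integrableD => //.
    exact: finite_measure_integrable_cst.
move=> EZ.
have m0 : m = 0.
  have : (\int[P]_w (Z w)%:E = m%:E)%E.
    under eq_integral do rewrite -(subrK m (Z _)) EFinD.
    rewrite integralD//; last exact: finite_measure_integrable_cst.
    rewrite I1 add0e integral_cst //= -[RHS]mule1; congr (_ * _)%E; exact: probability_setT.
  by rewrite EZ => -[].
exists (s ^+ 2).
move: I2 I4; rewrite m0.
under eq_integral do rewrite subr0.
move=> ->; under eq_integral do rewrite subr0.
by move=> ->; rewrite -exprM.
Qed.

End gaussian_law_moments.

(** * Quadratic variation of fractional Brownian motion *)

(* concavity of [x `^ p], obtained from the convexity of [x `^ p^-1] *)
Lemma powR_midpoint (R : realType) (p a b : R) : 0 < p <= 1 -> 0 <= a -> 0 <= b ->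
  a `^ p + b `^ p <= 2 * ((a + b) / 2) `^ p.
Proof.
move=> /andP[p0 p1] a0 b0.
have q1 : 1 <= p^-1 by rewrite invf_ge1.
have pq x : 0 <= x -> (x `^ p) `^ p^-1 = x.
  by move=> x0; rewrite -powRrM divff ?gt_eqF// powRr1.
have [A0 B0] : 0 <= a `^ p /\ 0 <= b `^ p by split; exact: powR_ge0.
have : (2^-1 * a `^ p + 2^-1 * b `^ p) `^ p^-1 <=
    2^-1 * (a `^ p) `^ p^-1 + 2^-1 * (b `^ p) `^ p^-1.
  rewrite {2 4}(_ : 2^-1 = 1 - 2^-1); last by field.
  by apply: (convex_powR q1 (Itv01 _ _)) => //=;
    rewrite ?inE/= ?in_itv/= ?andbT// ?invr_ge0// invf_le1 ?ler1n.
rewrite !pq// => h.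
have : ((2^-1 * a `^ p + 2^-1 * b `^ p) `^ p^-1) `^ p <= (2^-1 * a + 2^-1 * b) `^ p.
  rewrite ge0_ler_powR ?nnegrE ?powR_ge0// ?(ltW p0)//.
  by rewrite addr_ge0// mulr_ge0.
rewrite -powRrM mulVf ?gt_eqF// powRr1; last by rewrite addr_ge0// mulr_ge0.
rewrite -mulrDr -mulrDr [2^-1 * (a + b)]mulrC.
lra.
Qed.

(** * Covariances of fractional Gaussian noise *)

Section fgn.
Variables (R : realType) (p : R).
Hypothesis p01 : 0 < p <= 1.

(* fgn: fractional Gaussian noise, with [p] standing for [2 * H] *)
Definition fgn_cov (x : R) : R :=
  2^-1 * (`|x + 1| `^ p + `|x - 1| `^ p - 2 * `|x| `^ p).

Lemma fgn_covN x : fgn_cov (- x) = fgn_cov x.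
Proof.
rewrite /fgn_cov normrN -(normrN (- x + 1)) -(normrN (- x - 1)) !opprD !opprK.
by congr (_ * (_ - _)); rewrite addrC.
Qed.

Lemma fgn_cov0 : fgn_cov 0 = 1.
Proof.
have /andP[p0 _] := p01.
rewrite /fgn_cov add0r sub0r normrN normr1 powR1 normr0 powR0 ?gt_eqF//.
by field.
Qed.

Let delta (k : nat) : R := k.+1%:R `^ p - k%:R `^ p.

Let delta_ge0 k : 0 <= delta k.
Proof.
have /andP[p0 _] := p01.
by rewrite subr_ge0 ge0_ler_powR ?nnegrE ?ler_nat// ltW.
Qed.

Let delta0 : delta 0 = 1.
Proof.
have /andP[p0 _] := p01.
by rewrite /delta powR1 powR0 ?subr0// gt_eqF.
Qed.

Let delta_decr k : delta k.+1 <= delta k.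
Proof.
have := powR_midpoint p01 (ler0n R k.+2) (ler0n R k).
have -> : (k.+2%:R + k%:R) / 2 = k.+1%:R :> R.
  by rewrite -!natr1; field.
rewrite /delta; lra.
Qed.

(** At nonzero lag the covariance is half a second difference of [k^p], nonpositive by concavity. *)
Let fgn_covS k : fgn_cov k.+1%:R = - 2^-1 * (delta k - delta k.+1).
Proof.
rewrite /fgn_cov /delta.
have -> : k.+1%:R + 1 = k.+2%:R :> R by rewrite natr1.
have -> : k.+1%:R - 1 = k%:R :> R by rewrite -natr1 addrK.
rewrite !normr_nat; by field.
Qed.

(** The increments [delta] lie in [0, 1], so the covariance is at most 1 in absolute value and its
    square is at most that absolute value: a bound linear in [delta], ready to telescope. *)
Lemma sqr_fgn_cov_le k : fgn_cov k.+1%:R ^+ 2 <= 2^-1 * (delta k - delta k.+1).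
Proof.
rewrite fgn_covS.
have : delta k <= 1.
  elim: k => [|k ih]; first by rewrite delta0.
  exact: le_trans (delta_decr k) ih.
have := delta_ge0 k.+1; have := delta_decr k.
move: (delta k) (delta k.+1) => x y; nra.
Qed.

Lemma sum_sqr_fgn_cov_row n :
  \sum_(0 <= j < n) fgn_cov (n%:R - j%:R) ^+ 2 <= 2^-1.
Proof.
apply: (@le_trans _ _ (\sum_(0 <= j < n)
    (2^-1 * delta (n - j.+1)%N - 2^-1 * delta (n - j)%N))).
  rewrite !big_nat; apply: ler_sum => j /andP[_ jn].
  have -> : n%:R - j%:R = (n - j.+1)%N.+1%:R :> R by rewrite subnSK// natrB// ltnW.
  by rewrite -mulrBr (le_trans (sqr_fgn_cov_le _))// subnSK.
rewrite (telescope_sumr (fun j => 2^-1 * delta (n - j)%N))// subnn subn0 delta0.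
by rewrite mulr1 gerBl mulr_ge0.
Qed.

(** Each new index adds the diagonal entry 1 and, by symmetry, two off-diagonal rows of at most 1/2
    each. *)
Lemma sum_sqr_fgn_cov n :
  \sum_(0 <= i < n) \sum_(0 <= j < n) fgn_cov (i%:R - j%:R) ^+ 2 <= 2 * n%:R.
Proof.
elim: n => [|n ih]; first by rewrite big_nil mulr0.
rewrite big_nat_recr//= big_nat_recr//= subrr fgn_cov0 expr1n.
under eq_bigr do rewrite big_nat_recr//=.
rewrite big_split/=.
under [X in _ + X + _ <= _]eq_bigr do rewrite -fgn_covN opprB.
have := sum_sqr_fgn_cov_row n; move: ih; rewrite -(natr1 n); lra.
Qed.

End fgn.

(** * Real-valued expectations and mixed moments of Gaussian pairs *)

Section real_integrable.
Variables (R : realType) (d : measure_display) (Omega : measurableType d).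
Variable P : probability Omega R.
Implicit Types (f g : Omega -> R).

Definition rintegrable f := P.-integrable setT (EFin \o f).

Lemma rintegrableD f g : rintegrable f -> rintegrable g ->
  rintegrable (fun w => f w + g w).
Proof. by move=> If Ig; apply: (integrableD measurableT If Ig). Qed.

Lemma rintegrableZ (k : R) f : rintegrable f -> rintegrable (fun w => k * f w).
Proof. by move=> If; apply: (integrableZl measurableT k If). Qed.

Lemma rintegrableB f g : rintegrable f -> rintegrable g ->
  rintegrable (fun w => f w - g w).
Proof. by move=> If Ig; apply: (integrableB measurableT If Ig). Qed.

Lemma rintegrable_cst (k : R) : rintegrable (fun=> k).
Proof. exact: finite_measure_integrable_cst. Qed.

Lemma Rintegral_probability_cst (k : R) : \int[P]_w k = k.
Proof.
rewrite Rintegral_cst//= -[RHS]mulr1; congr (_ * _).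
by rewrite -[RHS]/(fine 1%E); congr fine; exact: probability_setT.
Qed.

Lemma rintegrable_sum (n : nat) (F : nat -> Omega -> R) :
  (forall k, (k < n)%N -> rintegrable (F k)) ->
  rintegrable (fun w => \sum_(0 <= k < n) F k w).
Proof.
elim: n => [_|n ih FI].
  by under eq_fun do rewrite big_nil; exact: rintegrable_cst.
under eq_fun do rewrite big_nat_recr//=.
by apply: rintegrableD; [apply: ih => k kn; apply: FI; exact: ltnW|exact: FI].
Qed.

Lemma Rintegral_sum (n : nat) (F : nat -> Omega -> R) :
  (forall k, (k < n)%N -> rintegrable (F k)) ->
  \int[P]_w (\sum_(0 <= k < n) F k w) = \sum_(0 <= k < n) \int[P]_w F k w.
Proof.
elim: n => [_|n ih FI].
  under eq_Rintegral do rewrite big_nil.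
  by rewrite big_nil Rintegral_probability_cst.
rewrite big_nat_recr//= -ih; last by move=> k kn; apply: FI; exact: ltnW.
under eq_Rintegral do rewrite big_nat_recr//=.
rewrite RintegralD//; last exact: FI.
by apply: rintegrable_sum => k kn; apply: FI; exact: ltnW.
Qed.

Lemma EFin_Rintegral f : rintegrable f ->
  (\int[P]_w (f w)%:E)%E = (\int[P]_w f w)%:E.
Proof. by move=> If; rewrite /Rintegral fineK//; exact: integrable_fin_num. Qed.

Lemma rintegrable_le4 f (k : nat) : (k <= 4)%N -> measurable_fun setT f ->
  rintegrable (fun w => f w ^+ 4) -> rintegrable (fun w => f w ^+ k).
Proof. exact: integrable_pow_le4. Qed.

(** Stated for bare functions so that it applies to linear combinations of processes. *)
Lemma gaussian_fourth_moment (Z : Omega -> R) : measurable_fun setT Z ->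
  gaussian_law (pushforward P Z) ->
  rintegrable (fun w => Z w ^+ 4) /\
  (\int[P]_w Z w = 0 ->
   \int[P]_w (Z w ^+ 4) = 3 * (\int[P]_w (Z w ^+ 2)) ^+ 2).
Proof.
move=> mZ gZ.
pose Y : {RV P >-> R} := HB.pack Z (isMeasurableFun.Build _ _ _ _ _ mZ).
have [i4 h] := @gaussian_centered _ _ _ P Y gZ.
split => // Z0.
have [|v [v2 v4]] := h.
  by rewrite EFin_Rintegral ?Z0//; exact: (@rintegrable_le4 _ 1).
by rewrite /Rintegral v2 v4.
Qed.

Section gaussian_pair.
Variables U V : Omega -> R.
Hypotheses (mU : measurable_fun setT U) (mV : measurable_fun setT V).
Hypothesis gUV : forall a b : R,
  gaussian_law (pushforward P (fun w => a * U w + b * V w)).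
Hypotheses (U0 : \int[P]_w U w = 0) (V0 : \int[P]_w V w = 0).

Let mc a b : measurable_fun setT (fun w => a * U w + b * V w).
Proof. by apply: measurable_funD; exact: measurable_funM. Qed.

Let g4 a b := gaussian_fourth_moment (@mc a b) (gUV a b).

Let i4 a b : rintegrable (fun w => (a * U w + b * V w) ^+ 4).
Proof. by case: (g4 a b). Qed.

Let ik a b k : (k <= 4)%N -> rintegrable (fun w => (a * U w + b * V w) ^+ k).
Proof. by move=> k4; apply: rintegrable_le4. Qed.

Let iU k : (k <= 4)%N -> rintegrable (fun w => U w ^+ k).
Proof.
move=> /(ik 1 0); congr rintegrable; apply/funext => w.
by rewrite mul1r mul0r addr0.
Qed.

Let iV k : (k <= 4)%N -> rintegrable (fun w => V w ^+ k).
Proof.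
move=> /(ik 0 1); congr rintegrable; apply/funext => w.
by rewrite mul1r mul0r add0r.
Qed.

Let iUV : rintegrable (fun w => U w * V w).
Proof.
have := rintegrableZ 4^-1 (rintegrableB (@ik 1 1 2 isT) (@ik 1 (-1) 2 isT)).
by congr rintegrable; apply/funext => w; field.
Qed.

Let E0 a b : \int[P]_w (a * U w + b * V w) = 0.
Proof.
have iU1 : rintegrable U by exact: (@iU 1).
have iV1 : rintegrable V by exact: (@iV 1).
rewrite RintegralD//; [|exact: rintegrableZ..].
by rewrite !RintegralZl// U0 V0 !mulr0 addr0.
Qed.

Let E2 a b : \int[P]_w ((a * U w + b * V w) ^+ 2) =
  a ^+ 2 * (\int[P]_w (U w ^+ 2)) + 2 * a * b * (\int[P]_w (U w * V w)) +
  b ^+ 2 * (\int[P]_w (V w ^+ 2)).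
Proof.
have iU2 := @iU 2 isT; have iV2 := @iV 2 isT.
rewrite -!RintegralZl// -RintegralD//; [|exact: rintegrableZ..].
rewrite -RintegralD//; [|by apply: rintegrableD; exact: rintegrableZ|exact: rintegrableZ].
by apply: eq_Rintegral => w _; ring.
Qed.

(* polarization of the fourth moments of [U], [V], [U + V] and [U - V] *)
Lemma gaussian_pair_moment :
  rintegrable (fun w => U w ^+ 2 * V w ^+ 2) /\
  \int[P]_w (U w ^+ 2 * V w ^+ 2) =
  (\int[P]_w (U w ^+ 2)) * (\int[P]_w (V w ^+ 2)) +
  2 * (\int[P]_w (U w * V w)) ^+ 2.
Proof.
(* The trivial coefficients 1 and 0 keep all four terms in the shape [a * U w + b * V w], so that
   [g4] and [E2] apply to each. *)
have eqf : (fun w => U w ^+ 2 * V w ^+ 2) = (fun w => 12^-1 *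
   (((1 * U w + 1 * V w) ^+ 4 + (1 * U w + (- 1) * V w) ^+ 4) -
    (2 * (1 * U w + 0 * V w) ^+ 4 + 2 * (0 * U w + 1 * V w) ^+ 4))).
  by apply/funext => w; field.
have iA := rintegrableD (i4 1 1) (i4 1 (-1)).
have iB := rintegrableD (rintegrableZ 2 (i4 1 0)) (rintegrableZ 2 (i4 0 1)).
rewrite eqf; split; first by apply: rintegrableZ; exact: rintegrableB.
rewrite RintegralZl//; last exact: rintegrableB.
rewrite RintegralB// [X in X - _]RintegralD; [|by []|exact: i4..].
rewrite [X in _ - X]RintegralD; [|by []|exact: rintegrableZ (i4 _ _)..].
rewrite !RintegralZl; [|by []|exact: i4|by []|exact: i4].
rewrite !(proj2 (g4 _ _))//.
rewrite !E2; by field.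
Qed.

End gaussian_pair.
End real_integrable.

(** * Mean square error of the quadratic variation *)

Section fbm_quadratic_variation.
Variables (R : realType) (d : measure_display) (Omega : measurableType d).
Variables (P : probability Omega R) (H : R) (B : R -> {RV P >-> R}).
Hypothesis hH : 0 < H < 2^-1.
Hypothesis hB : fractional_brownian_motion H B.
Local Notation I := (rintegrable P).

Lemma gaussian_increments (t1 t2 t3 t4 a b : R) :
  0 <= t1 -> 0 <= t2 -> 0 <= t3 -> 0 <= t4 ->
  gaussian_law (pushforward P
    (fun w => a * (B t2 w - B t1 w) + b * (B t4 w - B t3 w))).
Proof.
move=> h1 h2 h3 h4; have [gB _ _ _] := hB.
have := gB 4 (fun i => [:: t1; t2; t3; t4]`_i) (fun i => [:: - a; a; - b; b]`_i) _.
rewrite (_ : (fun w => \sum_(i < 4) _) =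
    (fun w => a * (B t2 w - B t1 w) + b * (B t4 w - B t3 w))).
  by apply=> -[[|[|[|[|]]]]].
by apply/funext => w; rewrite !big_ord_recl big_ord0 /=; ring.
Qed.

Lemma gaussian_marginal (t : R) : 0 <= t -> gaussian_law (pushforward P (B t)).
Proof.
move=> t0; have [gB _ _ _] := hB.
have := gB 1 (fun=> t) (fun=> 1) (fun=> t0).
rewrite (_ : (fun w => \sum_(i < 1) _) = B t)//.
by apply/funext => w; rewrite big_ord_recl big_ord0 /=; ring.
Qed.

Let mBt t : measurable_fun setT (B t). Proof. exact: measurable_funPT. Qed.

Lemma rintegrable_fbm_pow (t : R) k : (k <= 4)%N -> 0 <= t -> I (fun w => B t w ^+ k).
Proof.
move=> k4 t0; apply: rintegrable_le4 => //.
by case: (gaussian_fourth_moment (@mBt t) (gaussian_marginal t0)).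
Qed.

Lemma rintegrable_mul (f g : Omega -> R) :
  measurable_fun setT f -> measurable_fun setT g ->
  I (fun w => f w ^+ 2) -> I (fun w => g w ^+ 2) -> I (fun w => f w * g w).
Proof.
move=> mf mg If Ig.
apply: (@le_integrable _ _ _ _ _ measurableT _ (EFin \o (fun w => f w ^+ 2 + g w ^+ 2))).
- by apply/measurable_EFinP; exact: measurable_funM.
- move=> w _; rewrite /= lee_fin; apply: le_trans (ler_norm _).
  rewrite ler_norml; move: (f w) (g w) => x y; apply/andP; split; nra.
- exact: rintegrableD.
Qed.

Lemma rintegrable_fbm_mul (s t : R) : 0 <= s -> 0 <= t -> I (fun w => B t w * B s w).
Proof. by move=> s0 t0; apply: rintegrable_mul => //; exact: rintegrable_fbm_pow. Qed.

Lemma Rintegral_fbm (t : R) : 0 <= t -> \int[P]_w B t w = 0.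
Proof.
move=> t0; have [_ EB _ _] := hB; have := EB t t0.
by rewrite expectation_def /Rintegral => ->.
Qed.

Lemma Rintegral_fbm_mul (s t : R) : 0 <= s -> 0 <= t ->
  \int[P]_w (B t w * B s w) =
  2^-1 * (t `^ (2 * H) + s `^ (2 * H) - `|t - s| `^ (2 * H)).
Proof.
move=> s0 t0; have [_ _ EB _] := hB; have := EB s t s0 t0.
by rewrite unlock /Rintegral => ->.
Qed.

Section increments.
Variables (T : R) (n : nat).
Hypothesis hT : 0 < T.
Hypothesis hn : (0 < n)%N.
Local Notation tt k := (k%:R * T / n%:R).
Definition fbm_incr (k : nat) (w : Omega) : R := B (tt k.+1) w - B (tt k) w.
Local Notation xi := fbm_incr.
Let p := 2 * H.
(** The common variance of the increments. *)
Let h := (T / n%:R) `^ p.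

Let tt0 k : 0 <= tt k.
Proof. by rewrite divr_ge0// mulr_ge0// ltW. Qed.

Let mxi k : measurable_fun setT (xi k).
Proof. exact: measurable_funB. Qed.

Let ixi1 k : \int[P]_w xi k w = 0.
Proof.
have i j : I (B (tt j)) by exact: (@rintegrable_fbm_pow _ 1).
by rewrite RintegralB// ?Rintegral_fbm ?subrr//; exact: i.
Qed.

Let ixi4 k : I (fun w => xi k w ^+ 4).
Proof.
have g := gaussian_increments 1 0 (tt0 k) (tt0 k.+1) (tt0 k) (tt0 k.+1).
rewrite (_ : (fun w => _) = xi k) in g; last first.
  by apply/funext => w; rewrite /xi; ring.
by case: (gaussian_fourth_moment (@mxi k) g).
Qed.

Let ttB (x y : nat) : `|tt x - tt y| `^ p = h * `|x%:R - y%:R| `^ p.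
Proof.
have -> : tt x - tt y = (T / n%:R) * (x%:R - y%:R) by field; rewrite pnatr_eq0 -lt0n.
rewrite normrM ger0_norm; last by rewrite divr_ge0// ltW.
by rewrite powRM// divr_ge0// ltW.
Qed.

(** The powers of single times cancel in the mixed difference, and self-similarity ([ttB]) pulls out
    the mesh; the noise with unit mesh at lag [j - k] remains. *)
Lemma fbm_incr_cov j k :
  \int[P]_w (xi j w * xi k w) = h * fgn_cov p (j%:R - k%:R).
Proof.
have iM x y : I (fun w => B (tt x) w * B (tt y) w) by exact: rintegrable_fbm_mul.
have -> : \int[P]_w (xi j w * xi k w) = \int[P]_w
   ((B (tt j.+1) w * B (tt k.+1) w - B (tt j.+1) w * B (tt k) w) -
    (B (tt j) w * B (tt k.+1) w - B (tt j) w * B (tt k) w)).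
  by apply: eq_Rintegral => w _; rewrite /xi; ring.
rewrite RintegralB; [|by []|exact: rintegrableB..].
rewrite !RintegralB; [|by []|exact: iM|exact: iM|by []|exact: iM|exact: iM].
rewrite !Rintegral_fbm_mul// -/p !ttB /fgn_cov.
have -> : j.+1%:R - k.+1%:R = j%:R - k%:R :> R by rewrite -!natr1; ring.
have -> : j.+1%:R - k%:R = j%:R - k%:R + 1 :> R by rewrite -!natr1; ring.
have -> : j%:R - k.+1%:R = j%:R - k%:R - 1 :> R by rewrite -!natr1; ring.
by field.
Qed.

Let ixi2 k : I (fun w => xi k w ^+ 2). Proof. exact: rintegrable_le4 (ixi4 k). Qed.

Let p01 : 0 < p <= 1.
Proof. by rewrite /p; move: hH => /andP[? ?]; apply/andP; split; lra. Qed.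

Lemma fbm_incr_var k : \int[P]_w (xi k w ^+ 2) = h.
Proof.
have := fbm_incr_cov k k.
rewrite subrr fgn_cov0// mulr1 => <-.
by apply: eq_Rintegral => w _; rewrite expr2.
Qed.

Let Y k w := xi k w ^+ 2 - h.

Let pair j k := gaussian_pair_moment (@mxi j) (@mxi k)
  (fun a b => gaussian_increments a b (tt0 j) (tt0 j.+1) (tt0 k) (tt0 k.+1))
  (@ixi1 j) (@ixi1 k).

Let iYY j k : I (fun w => Y j w * Y k w).
Proof.
have := rintegrableB (proj1 (pair j k)) (rintegrableB (rintegrableD
   (rintegrableZ h (ixi2 j)) (rintegrableZ h (ixi2 k))) (rintegrable_cst P (h * h))).
by congr rintegrable; apply/funext => w; rewrite /Y; ring.
Qed.

Let EYY j k : \int[P]_w (Y j w * Y k w) = 2 * h ^+ 2 * fgn_cov p (j%:R - k%:R) ^+ 2.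
Proof.
have i1 := rintegrableD (rintegrableZ h (ixi2 j)) (rintegrableZ h (ixi2 k)).
have i2 := rintegrable_cst P (h * h).
have -> : \int[P]_w (Y j w * Y k w) = \int[P]_w (xi j w ^+ 2 * xi k w ^+ 2 -
   (h * xi j w ^+ 2 + h * xi k w ^+ 2 - h * h)).
  by apply: eq_Rintegral => w _; rewrite /Y; ring.
have [i3 E3] := pair j k.
rewrite RintegralB; [|by []|exact: i3|exact: rintegrableB].
rewrite E3 RintegralB; [|by []|exact: i1|exact: i2].
rewrite RintegralD; [|by []|exact: rintegrableZ..].
rewrite Rintegral_probability_cst !RintegralZl; [|by []|exact: ixi2|by []|exact: ixi2].
rewrite !fbm_incr_var fbm_incr_cov.
by ring.
Qed.

(** The 4 is a 2 from the Gaussian pair formula times the 2 of [sum_sqr_fgn_cov]. The factor [n], in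
    place of the number n^2 of pairs, reflects the summable squared correlations. *)
Lemma fbm_quadratic_variation_error :
  I (fun w => (\sum_(0 <= k < n) (xi k w ^+ 2 - h)) ^+ 2) /\
  \int[P]_w ((\sum_(0 <= k < n) (xi k w ^+ 2 - h)) ^+ 2) <= 4 * h ^+ 2 * n%:R.
Proof.
have eqf : (fun w => (\sum_(0 <= k < n) (xi k w ^+ 2 - h)) ^+ 2) =
    (fun w => \sum_(0 <= j < n) \sum_(0 <= k < n) Y j w * Y k w).
  apply/funext => w; rewrite expr2 mulr_suml; apply: eq_bigr => j _.
  by rewrite mulr_sumr.
have iS j : I (fun w => \sum_(0 <= k < n) Y j w * Y k w).
  by apply: rintegrable_sum => k _.
rewrite eqf; split; first exact: rintegrable_sum.
rewrite Rintegral_sum//.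
under eq_bigr do rewrite Rintegral_sum//.
under eq_bigr do under eq_bigr do rewrite EYY.
under eq_bigr do rewrite -mulr_sumr.
rewrite -mulr_sumr.
have := sum_sqr_fgn_cov p01 n.
have : 0 <= h ^+ 2 by exact: sqr_ge0.
move: (\sum_(0 <= i < n) _) (h ^+ 2) => S h2 h20; nra.
Qed.
End increments.
End fbm_quadratic_variation.

(** * The regularized equations *)

Section last_exit.
Variable R : realType.

(** Serves the comparison arguments: after the last time at level [c] the sign of [g - c] is known
    up to [t], so pointwise drift inequalities can be integrated over []s, t]]. *)
Lemma last_exit (g : R -> R) (c t : R) : continuous g -> 0 <= t ->
  c <= g 0 -> g t < c ->
  exists s, [/\ 0 <= s, s < t, c <= g s & forall u, s < u <= t -> g u < c].
Proof.
move=> cg t0 c0 gt.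
pose A := [set s | 0 <= s <= t /\ c <= g s].
have A0 : A 0 by split => //; rewrite lexx.
have hA : has_sup A by split; [exists 0|exists t => s [/andP[]]].
have ubA u : A u -> u <= sup A by move=> Au; exact: (sup_upper_bound hA).
have s0 : 0 <= sup A by exact: ubA.
have st : sup A <= t by apply: ge_sup; [exists 0|move=> s [/andP[]]].
have cs : c <= g (sup A).
  rewrite leNgt; apply/negP => gs.
  have /nbhs_ballP[e /= e0 he] : \forall u \near sup A, g u < c.
    exact: (cvgr_lt (g (sup A)) (cg (sup A)) c gs).
  have [u Au su] := sup_adherent e0 hA.
  have us : u <= sup A by exact: ubA.
  have : g u < c.
    by apply: he; rewrite /ball/= ger0_norm ?subr_ge0// ltrBlDr addrC -ltrBlDr.
  by case: Au => _; rewrite leNgt => /negP.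
have st' : sup A < t.
  rewrite lt_neqAle st andbT; apply: contraTneq gt => <-; by rewrite -leNgt.
exists (sup A); split => // u /andP[su ut].
rewrite ltNge; apply/negP => gu.
have : u <= sup A.
  by apply: ubA; split => //; rewrite ut andbT (le_trans s0)// ltW.
by rewrite leNgt su.
Qed.

End last_exit.

Section drift.
Variables (R : realType) (a : R).
Hypothesis ha : 0 < a.
Implicit Types (e x y : R).

Definition drift e x : R := a / (x * (0 < x)%R%:R + e).

Lemma driftE e x : drift e x = a / (Num.max x 0 + e).
Proof.
rewrite /drift; congr (_ / (_ + _)).
by case: ltP => [x0|x0]; rewrite ?mulr1 ?mulr0.
Qed.

Lemma drift_den_gt0 e x : 0 < e -> 0 < Num.max x 0 + e.
Proof. by move=> e0; rewrite ltr_wpDl// le_max lexx orbT. Qed.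

Lemma drift_ge0 e x : 0 < e -> 0 <= drift e x.
Proof. by move=> e0; rewrite driftE divr_ge0 ?ltW ?drift_den_gt0. Qed.

Lemma drift_anti e1 e2 x y : 0 < e1 -> e1 <= e2 -> x <= y ->
  drift e2 y <= drift e1 x.
Proof.
move=> e10 e12 xy; have e20 := lt_le_trans e10 e12.
rewrite !driftE ler_wpM2l ?(ltW ha)// lef_pV2 ?posrE ?drift_den_gt0//.
by rewrite lerD// ge_max le_max xy/= le_max lexx orbT.
Qed.

Lemma drift_le e x (c : R) : 0 < e -> 0 < c -> c <= x -> drift e x <= a / c.
Proof.
move=> e0 c0 cx; rewrite driftE ler_wpM2l ?(ltW ha)//.
rewrite lef_pV2 ?posrE ?drift_den_gt0//.
by rewrite (le_trans cx)// ler_wpDr ?(ltW e0)// le_max lexx.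
Qed.

Lemma drift_le_inv e x : 0 < e -> drift e x <= a / e.
Proof.
move=> e0; rewrite driftE ler_wpM2l ?(ltW ha)//.
by rewrite lef_pV2 ?posrE ?drift_den_gt0// lerDr le_max lexx orbT.
Qed.

Lemma drift_lip e x y : 0 < e -> x <= y ->
  drift e x - drift e y <= a / e ^+ 2 * (y - x).
Proof.
move=> e0 xy; rewrite !driftE.
have : Num.max y 0 - Num.max x 0 <= y - x.
  by case: (ltP y 0) => ?; case: (ltP x 0) => ?; lra.
have : 0 <= Num.max x 0 by rewrite le_max lexx orbT.
have : Num.max x 0 <= Num.max y 0 by rewrite ge_max !le_max xy lexx orbT.
move: (Num.max x 0) (Num.max y 0) => u v uv u0 vu.
have -> : a / (u + e) - a / (v + e) = a * ((v - u) / ((u + e) * (v + e))).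
  by field; rewrite !gt_eqF//; lra.
rewrite -mulrA ler_wpM2l ?(ltW ha)// mulrC ler_pM//.
- by rewrite invr_ge0 mulr_ge0//; lra.
- by lra.
- rewrite lef_pV2 ?posrE; nra.
Qed.

Lemma continuous_drift e : 0 < e -> continuous (drift e).
Proof.
move=> e0 x; rewrite (_ : drift e = fun x => a / (Num.max x 0 + e)); last first.
  by apply/funext => y; rewrite driftE.
apply: cvgM; first exact: cvg_cst.
apply: cvgV; first by rewrite gt_eqF// drift_den_gt0.
apply: cvgD; last exact: cvg_cst.
apply: continuous_max; first exact: cvg_id.
exact: cvg_cst.
Qed.

(* one explicit Euler step is nonexpansive because the drift is nonincreasing *)
Lemma euler_step_nonexpansive e h x y : 0 < e -> 0 <= h -> h * (a / e ^+ 2) <= 1 ->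
  `|(x + h * drift e x) - (y + h * drift e y)| <= `|x - y|.
Proof.
move=> e0 h0 hL; wlog xy : x y / x <= y.
  move=> W; have [/W//|/ltW/W] := leP x y.
  by rewrite distrC (distrC y).
rewrite (distrC x) (ger0_norm (_ : 0 <= y - x)) ?subr_ge0// ler_norml.
have l1 := drift_lip e0 xy.
have l2 := drift_anti e0 (lexx e) xy.
have l3 : h * (drift e x - drift e y) <= h * (a / e ^+ 2) * (y - x).
  by rewrite -mulrA ler_wpM2l.
apply/andP; split; nra.
Qed.

End drift.

Section regularized.
Variables (R : realType) (x0 a sigma : R).
Hypotheses (hx0 : 0 < x0) (ha : 0 < a) (hsigma : 0 < sigma).
Implicit Types (e s t T : R) (b x y : R -> R).
Local Notation mu := (@lebesgue_measure R).
Local Notation sol := (regularized_solution x0 a sigma).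

(* Solutions are only controlled for [t >= 0]; clamping makes them continuous on
   the whole line. *)
Definition clamp (x : R -> R) (t : R) := x (Num.max t 0).

Lemma continuous_clamp x : {within `[0, +oo[, continuous x} ->
  continuous (clamp x).
Proof.
move=> /subspace_continuousP cx t.
have m0 : `[0, +oo[%classic (Num.max t 0) by rewrite /= in_itv/= andbT le_max lexx orbT.
have cm : Num.max s 0 @[s --> t] --> Num.max t 0.
  apply: (@continuous_max _ _ id (cst 0) t); first exact: cvg_id.
  exact: cvg_cst.
move=> U hU.
have hU' : nbhs (Num.max t 0) [set s | `[0, +oo[%classic s -> U (x s)] := cx _ m0 U hU.
change (nbhs t [set s | U (clamp x s)]).
apply: (@filterS _ (nbhs t) _ _ _ _ (cm _ hU')) => s /=; apply.
by rewrite in_itv/= andbT le_max lexx orbT.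
Qed.

Lemma clampE x t : 0 <= t -> clamp x t = x t.
Proof. by move=> t0; rewrite /clamp max_l. Qed.

Lemma integrable_drift e y s t : 0 < e -> continuous y ->
  mu.-integrable `[s, t] (EFin \o (fun u => drift a e (y u))).
Proof.
move=> e0 cy; apply: continuous_compact_integrable; first exact: segment_compact.
apply: continuous_subspaceT => u.
by apply: continuous_comp; [exact: cy|exact: continuous_drift].
Qed.

Lemma integrable_drift_oc e y s t : 0 < e -> continuous y ->
  mu.-integrable `]s, t] (EFin \o (fun u => drift a e (y u))).
Proof.
move=> e0 cy; apply: integrableS (integrable_drift s t e0 cy) => //.
by apply: subset_itvr; rewrite bnd_simp.
Qed.

Lemma regularized_clamp e b x t : 0 < e -> sol e b x -> 0 <= t ->
  clamp x t = x0 + \int[mu]_(u in `[0, t]) drift a e (clamp x u) + sigma * b t.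
Proof.
move=> e0 [_ hx] t0; rewrite clampE// hx//; congr (_ + _ + _).
apply: eq_Rintegral => u; rewrite inE/= in_itv/= => /andP[u0 _].
by rewrite clampE.
Qed.

Lemma regularized_incr e b x s t : 0 < e -> sol e b x -> 0 <= s -> s <= t ->
  clamp x t - clamp x s =
  \int[mu]_(u in `]s, t]) drift a e (clamp x u) + sigma * (b t - b s).
Proof.
move=> e0 hx s0 st; have t0 := le_trans s0 st.
have cx := continuous_clamp hx.1.
rewrite !(regularized_clamp e0 hx)// -(@Rintegral_itvB _ _ (BLeft 0)) ?bnd_simp//.
  by ring.
exact: integrable_drift.
Qed.

(** The term [b 0] stays, because the covariance makes [B 0] vanish only almost surely while the
    argument is pathwise. *)
Lemma regularized_start e b x : 0 < e -> sol e b x -> clamp x 0 = x0 + sigma * b 0.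
Proof.
move=> e0 hx; rewrite (regularized_clamp e0 hx)//.
by rewrite set_itv1 Rintegral_set1 addr0.
Qed.

Lemma Rintegral_oc_cst (c s t : R) : s <= t -> \int[mu]_(u in `]s, t]) c = c * (t - s).
Proof.
move=> st; rewrite Rintegral_cst//= lebesgue_measure_itv/= lte_fin.
case: ltP => //= ts; have -> : s = t by apply/eqP; rewrite eq_le st.
by rewrite subrr.
Qed.

Lemma integrable_oc_cst (c s t : R) : mu.-integrable `]s, t] (EFin \o (fun=> c)).
Proof.
apply: (@integrableS _ _ _ mu `[s, t]) => //.
  by apply: subset_itvr; rewrite bnd_simp.
apply: continuous_compact_integrable; first exact: segment_compact.
by apply: continuous_subspaceT => u; exact: cvg_cst.
Qed.

Lemma drift_integral_ge0 e y s t : 0 < e -> 0 <= \int[mu]_(u in `]s, t]) drift a e (y u).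
Proof. by move=> e0; apply: Rintegral_ge0 => u _; exact: drift_ge0. Qed.

Lemma drift_integral_le e y s t (c : R) : 0 < e -> continuous y -> s <= t ->
  (forall u, s < u <= t -> drift a e (y u) <= c) ->
  \int[mu]_(u in `]s, t]) drift a e (y u) <= c * (t - s).
Proof.
move=> e0 cy st hc; rewrite -Rintegral_oc_cst//; apply: le_Rintegral => //.
- exact: integrable_drift_oc.
- exact: integrable_oc_cst.
Qed.

(** If [x2] were above [x1] at [t], then since the last time with [x2 <= x1] the drift of [x1] would
    have been the larger one, both for its smaller [e] and for its lower position; the noise
    cancels. *)
Lemma regularized_anti e1 e2 b x1 x2 t : 0 < e1 -> e1 <= e2 ->
  sol e1 b x1 -> sol e2 b x2 -> 0 <= t -> clamp x2 t <= clamp x1 t.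
Proof.
move=> e10 e12 h1 h2 t0; have e20 := lt_le_trans e10 e12.
have c1 := continuous_clamp h1.1; have c2 := continuous_clamp h2.1.
rewrite leNgt; apply/negP => lt12.
have cg : continuous (fun u => clamp x1 u - clamp x2 u).
  by move=> u; apply: cvgB; [exact: c1|exact: c2].
have [||s [s0 st gs gu]] := @last_exit R _ 0 t cg t0.
- by rewrite (regularized_start e10 h1) (regularized_start e20 h2) subrr.
- by rewrite subr_lt0.
have := regularized_incr e10 h1 s0 (ltW st).
have := regularized_incr e20 h2 s0 (ltW st).
have : \int[mu]_(u in `]s, t]) drift a e2 (clamp x2 u) <=
       \int[mu]_(u in `]s, t]) drift a e1 (clamp x1 u).
  apply: le_Rintegral => //; [exact: integrable_drift_oc..|] => u.
  rewrite /= in_itv/= => /gu; rewrite subr_lt0 => /ltW.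
  exact: drift_anti.
move: gs lt12; rewrite subr_ge0; lra.
Qed.

(** After the last time below the level [x0 + M] the drift is at most [a / x0]. The level, chosen
    above the starting value, accounts for one [M] and the noise increment for two. The bound is
    uniform in [e]. *)
Lemma regularized_bound e b x (M T t : R) : 0 < e -> sol e b x ->
  (forall u, 0 <= u <= T -> `|sigma * b u| <= M) -> 0 <= t <= T ->
  clamp x t <= x0 + a / x0 * T + 3 * M.
Proof.
move=> e0 hx hM /andP[t0 tT]; have cx := continuous_clamp hx.1.
have aT : 0 <= a / x0 * T by apply: mulr_ge0; [apply: divr_ge0; exact: ltW|exact: le_trans tT].
have M0 : 0 <= M by apply: le_trans (hM t _) => //; rewrite t0.
have [le|gt] := leP (clamp x t) (x0 + M); first by lra.
have cg : continuous (fun u => - clamp x u) by move=> u; apply: cvgN; exact: cx.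
have [||s [s0 st gs gu]] := @last_exit R _ (- (x0 + M)) t cg t0.
- rewrite lerN2 (regularized_start e0 hx) lerD2l (le_trans (ler_norm _))//.
  by apply: hM; rewrite lexx (le_trans t0).
- by rewrite ltrN2.
have := regularized_incr e0 hx s0 (ltW st).
have : \int[mu]_(u in `]s, t]) drift a e (clamp x u) <= a / x0 * (t - s).
  apply: drift_integral_le => //; first exact: ltW.
  move=> u /gu; rewrite ltrN2 => hu; apply: drift_le => //.
  by rewrite (le_trans _ (ltW hu))// lerDl.
have : a / x0 * (t - s) <= a / x0 * T.
  apply: ler_wpM2l; [by apply: divr_ge0; exact: ltW|lra].
have := hM t; have := hM s.
rewrite t0 tT s0 (le_trans (ltW st) tT) => /(_ isT) + /(_ isT).
rewrite !ler_norml => /andP[? ?] /andP[? ?].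
move: gs; rewrite lerN2; lra.
Qed.

Lemma regularized_modulus e b x (C l : R) s t : 0 < e -> sol e b x ->
  0 <= s -> s <= t -> `|b t - b s| <= C * `|t - s| `^ l ->
  `|clamp x t - clamp x s| <= a / e * (t - s) + sigma * (C * `|t - s| `^ l).
Proof.
move=> e0 hx s0 st hb; have cx := continuous_clamp hx.1.
rewrite (regularized_incr e0 hx s0 st) (le_trans (ler_normD _ _))// lerD//.
  rewrite ger0_norm ?drift_integral_ge0//.
  by apply: drift_integral_le => // u _; exact: drift_le_inv.
by rewrite normrM ger0_norm ?ler_wpM2l// ltW.
Qed.

(** The noise increments are exact at grid points, so the only error comes from freezing the drift
    during a step. *)
Fixpoint euler e b (h : R) (k : nat) : R :=
  if k is k'.+1 then euler e b h k' + h * drift a e (euler e b h k') +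
    sigma * (b (k'.+1%:R * h) - b (k'%:R * h))
  else x0 + sigma * b 0.

(** Local errors add up without growth because steps are nonexpansive. Freezing the drift for one
    step costs at most [h] times its Lipschitz constant times the modulus [om]. *)
Lemma euler_error e b x (h om : R) (N k : nat) : 0 < e -> sol e b x ->
  0 <= h -> h * (a / e ^+ 2) <= 1 ->
  (forall s t, 0 <= s -> s <= t -> t <= N%:R * h -> t - s <= h ->
     `|clamp x t - clamp x s| <= om) ->
  (k <= N)%N ->
  `|clamp x (k%:R * h) - euler e b h k| <= k%:R * (h * (a / e ^+ 2) * om).
Proof.
move=> e0 hx h0 hL hom; have cx := continuous_clamp hx.1.
elim: k => [_|k ih kN]; first by rewrite !mul0r /= (regularized_start e0 hx) subrr normr0.
pose s := k%:R * h; pose t := k.+1%:R * h.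
have st : t - s = h by rewrite /s /t -natr1; ring.
have s_ge0 : 0 <= s by rewrite mulr_ge0.
have les : s <= t by rewrite -subr_ge0 st.
have tN : t <= N%:R * h by rewrite ler_wpM2r// ler_nat.
have := regularized_incr e0 hx s_ge0 les.
set J := Rintegral _ _ _ => hincr.
have -> : clamp x t - euler e b h k.+1 =
    ((clamp x s + h * drift a e (clamp x s)) -
     (euler e b h k + h * drift a e (euler e b h k))) +
    (J - h * drift a e (clamp x s)).
  rewrite /= -/s -/t.
  have -> : clamp x t = clamp x s + (J + sigma * (b t - b s)) by rewrite -hincr addrC subrK.
  by ring.
rewrite (le_trans (ler_normD _ _))// -natr1 [leRHS]mulrDl mul1r lerD//.
  rewrite (le_trans (euler_step_nonexpansive ha _ _ e0 h0 hL))//.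
  by apply: ih; exact: ltnW.
have -> : J - h * drift a e (clamp x s) =
    \int[mu]_(u in `]s, t]) (drift a e (clamp x u) - drift a e (clamp x s)).
  rewrite RintegralB//; [|exact: integrable_drift_oc|exact: integrable_oc_cst].
  by rewrite Rintegral_oc_cst// st mulrC.
have bnd u : s < u <= t ->
    `|drift a e (clamp x u) - drift a e (clamp x s)| <= a / e ^+ 2 * om.
  move=> /andP[su ut].
  have hu : `|clamp x u - clamp x s| <= om.
    by apply: hom => //; [exact: ltW|exact: le_trans tN|rewrite -st lerB].
  have L0 : 0 <= a / e ^+ 2 by rewrite divr_ge0 ?ltW// exprn_gt0.
  apply: (le_trans _ (ler_wpM2l L0 hu)).
  have [le|/ltW le] := leP (clamp x u) (clamp x s).
    rewrite ger0_norm ?subr_ge0 ?drift_anti//.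
    by rewrite ler0_norm ?subr_le0// opprB drift_lip.
  rewrite ler0_norm ?subr_le0 ?drift_anti// opprB.
  by rewrite ger0_norm ?subr_ge0// drift_lip.
have iB : mu.-integrable `]s, t]
    (EFin \o (fun u => drift a e (clamp x u) - drift a e (clamp x s))).
  have mJ : measurable (`]s, t]%classic : set (measurableTypeR R)) by exact: measurable_itv.
  exact: (integrableB mJ (integrable_drift_oc s t e0 cx)
    (integrable_oc_cst (drift a e (clamp x s)) s t)).
rewrite (le_trans (le_normr_Rintegral _ _))//.
rewrite (_ : h * (a / e ^+ 2) * om = (a / e ^+ 2 * om) * (t - s)); last by rewrite st; ring.
rewrite -Rintegral_oc_cst//; apply: le_Rintegral => //.
- exact: (integrable_norm iB).
- exact: integrable_oc_cst.
Qed.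

End regularized.

Lemma cvg_powR0 (R : realType) (l : R) (u : R^nat) : 0 < l ->
  (forall n, 0 <= u n) -> u n @[n --> \oo] --> 0 -> u n `^ l @[n --> \oo] --> 0.
Proof.
move=> l0 u0 cu; apply/cvgr0Pnorm_le => e e0.
have d0 : 0 < e `^ l^-1 by exact: powR_gt0.
near=> n.
have un : u n <= e `^ l^-1.
  rewrite -(ger0_norm (u0 n)); near: n.
  by move/cvgr0Pnorm_le : cu; exact.
rewrite ger0_norm ?powR_ge0//.
rewrite (_ : e = (e `^ l^-1) `^ l); last first.
  by rewrite -powRrM mulVf ?gt_eqF// powRr1// ltW.
by rewrite ge0_ler_powR ?nnegrE ?powR_ge0// ltW.
Unshelve. all: by end_near. Qed.

(** * Existence, measurability and monotone drift of the limit process *)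

Section rough_bessel.
Variables (R : realType) (d : measure_display) (Omega : measurableType d).
Variables (P : probability Omega R) (H x0 a sigma : R).
Hypotheses (hH : 0 < H) (hx0 : 0 < x0) (ha : 0 < a) (hsigma : 0 < sigma).
Variables (B : R -> {RV P >-> R}) (Xeps : R -> R -> Omega -> R).
Hypothesis hB : fractional_brownian_motion H B.
Hypothesis hX : forall (e : R) (w : Omega), 0 < e ->
  regularized_solution x0 a sigma e (fun t => B t w) (fun t => Xeps e t w).
Local Notation b w := (fun t => B t w).

Lemma measurable_euler (e h : R) k : 0 < e ->
  measurable_fun setT (fun w => euler x0 a sigma e (b w) h k).
Proof.
move=> e0; elim: k => [|k ih] /=.
  by apply: measurable_funD => //; exact: measurable_funM.
apply: measurable_funD.
  apply: measurable_funD => //; apply: measurable_funM => //.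
  apply: (measurableT_comp _ ih).
  by apply: continuous_measurable_fun; exact: continuous_drift.
by apply: measurable_funM => //; exact: measurable_funB.
Qed.

(** [H / 2] stands for any admissible exponent. [hoelder_on] leaves the sign of its constant open,
    hence the absolute value in the proof. *)
Lemma fbm_hoelder w (T : R) : 0 < T -> exists2 C : R, 0 <= C & forall s t : R,
  0 <= s <= T -> 0 <= t <= T -> `|B t w - B s w| <= C * `|t - s| `^ (H / 2).
Proof.
move=> T0; have [_ _ _ hh] := hB.
have [|C hC] := hh w (H / 2) T _ T0.
  by apply/andP; split; rewrite ?ltr_pdivrMr ?divr_gt0 // ltr_pMr ?ltr1n //.
exists `|C| => // s t hs ht.
apply: le_trans (hC s t _ _) _; rewrite /= ?in_itv//=.
by rewrite ler_wpM2r ?powR_ge0// ler_norm.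
Qed.

(** [a / e ^+ 2] is the Lipschitz constant of the drift. The offset in the number of steps keeps its
    product with the step size at most 1 for every [N], as [euler_error] demands. *)
Lemma euler_cvg (e t : R) w : 0 < e -> 0 <= t ->
  euler x0 a sigma e (b w) (t / (N + (Num.trunc (t * (a / e ^+ 2))).+1)%:R)
    (N + (Num.trunc (t * (a / e ^+ 2))).+1) @[N --> \oo] --> Xeps e t w.
Proof.
move=> e0 t0; have hx := hX w e0.
pose L := a / e ^+ 2; pose K := (Num.trunc (t * L)).+1.
have L0 : 0 <= L by rewrite divr_ge0 ?ltW// exprn_gt0.
pose h N : R := t / (N + K)%:R.
have NK N : 0 < (N + K)%:R :> R by rewrite ltr0n addnS.
have h0 N : 0 <= h N by rewrite divr_ge0 // ltW.
(* The horizon is [t + 1] because it must be positive while [t] may be 0. *)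
have [|C C0 hC] := @fbm_hoelder w (t + 1); first by rewrite ltr_wpDl.
pose om N := a / e * h N + sigma * (C * h N `^ (H / 2)).
have herr N : `|Xeps e t w - euler x0 a sigma e (b w) (h N) (N + K)| <= t * L * om N.
  have tE : (N + K)%:R * h N = t by rewrite /h mulrC divfK// gt_eqF.
  have hL : h N * L <= 1.
    rewrite /h mulrAC ler_pdivrMr// mul1r.
    rewrite (le_trans (ltW (truncnS_gt _)))// ler_nat.
    exact: leq_addl.
  have := @euler_error R x0 a sigma ha e (b w) _ (h N) (om N) (N + K) (N + K) e0 hx (h0 N) hL.
  rewrite tE clampE// leqnn => herr.
  rewrite (_ : t * L * om N = (N + K)%:R * (h N * L * om N)); last first.
    by rewrite -[in LHS]tE !mulrA.
  apply: herr => // s u s0 su ut us.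
  have us0 : 0 <= u - s by rewrite subr_ge0.
  have hb : `|B u w - B s w| <= C * `|u - s| `^ (H / 2).
    by apply: hC; apply/andP; split; lra.
  rewrite (le_trans (regularized_modulus ha hsigma e0 hx s0 su hb))//.
  rewrite (ger0_norm us0) lerD//.
    by apply: ler_wpM2l => //; apply: divr_ge0; exact: ltW.
  rewrite ler_wpM2l ?(ltW hsigma)// ler_wpM2l// ge0_ler_powR ?nnegrE//.
  by rewrite divr_ge0// ltW.
have ch : h N @[N --> \oo] --> 0.
  apply: (@squeeze_cvgr _ _ _ _ (cst 0) (fun N => t * @harmonic R N)).
  - apply: nearW => N /=; rewrite h0 /h ler_wpM2l// /harmonic/=.
    rewrite lef_pV2 ?posrE ?NK// ?ltr0n//.
    by rewrite ler_nat addnS ltnS leq_addr.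
  - exact: cvg_cst.
  - by rewrite -[0](mulr0 t); apply: cvgMr; exact: cvg_harmonic.
have com : t * L * om N @[N --> \oo] --> 0.
  rewrite -[0](mulr0 (t * L)); apply: cvgMr.
  rewrite -[0]addr0; apply: cvgD.
    by rewrite -[0](mulr0 (a / e)); apply: cvgMr.
  rewrite -[0](mulr0 sigma); apply: cvgMr.
  rewrite -[0](mulr0 C); apply: cvgMr.
  by apply: cvg_powR0 => //; rewrite divr_gt0.
apply/cvgrPdist_le => eps eps0.
near=> N; apply: le_trans (herr N) _.
near: N; exact: cvgr_le com _ eps0.
Unshelve. all: by end_near. Qed.

Lemma measurable_Xeps (e t : R) : 0 < e -> 0 <= t -> measurable_fun setT (Xeps e t).
Proof.
move=> e0 t0; apply: measurable_fun_cvg; last first.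
  by move=> w _; exact: euler_cvg e0 t0.
by move=> N; exact: measurable_euler.
Qed.

Local Notation X := (rough_bessel Xeps).

(** [lim] has its intended meaning only once convergence is known; here it is monotone convergence,
    from [regularized_anti] and the bound uniform in [e]. *)
Lemma rough_bessel_cvg (t : R) w : 0 <= t -> Xeps e t w @[e --> 0^'+] --> X t w.
Proof.
move=> t0; rewrite /rough_bessel.
have [|C C0 hC] := @fbm_hoelder w (t + 1); first by rewrite ltr_wpDl.
have [M hM] : exists M : R, forall u, 0 <= u <= t -> `|sigma * B u w| <= M.
  exists (sigma * (`|B 0 w| + C * (t + 1) `^ (H / 2))) => u /andP[u0 ut].
  have -> : B u w = B 0 w + (B u w - B 0 w) by ring.
  rewrite normrM (gtr0_norm hsigma) ler_wpM2l ?(ltW hsigma)//.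
  rewrite (le_trans (ler_normD _ _))// lerD2l (le_trans (hC 0 u _ _))//.
  - by rewrite lexx addr_ge0.
  - by rewrite u0 (le_trans ut)// lerDl.
  - rewrite subr0 ger0_norm// ler_wpM2l// ge0_ler_powR ?nnegrE//.
    + by rewrite divr_ge0// ltW.
    + by rewrite addr_ge0.
    + by rewrite (le_trans ut)// lerDl.
apply: (cvgP (sup ((fun e => Xeps e t w) @` `]0, 1[))).
apply: (@nonincreasing_at_right_cvgr _ (fun e => Xeps e t w) 0 (BLeft 1)).
- by rewrite bnd_simp.
- move=> e1 e2; rewrite !in_itv/= => /andP[e10 _] /andP[e20 _] e12.
  have := regularized_anti ha e10 e12 (hX w e10) (hX w e20) t0.
  by rewrite !clampE.
- exists (x0 + a / x0 * t + 3 * M) => _ [e /= + <-].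
  rewrite in_itv/= => /andP[e0 _].
  have := regularized_bound hx0 ha e0 (hX w e0) hM (_ : 0 <= t <= t).
  by rewrite clampE// t0 lexx => ->.
Qed.

(** Passing to a sequence lets measurability survive the limit. *)
Lemma rough_bessel_cvg_seq (t : R) w : 0 <= t ->
  Xeps (@harmonic R n) t w @[n --> \oo] --> X t w.
Proof.
move=> t0; have /cvg_at_rightP := @rough_bessel_cvg t w t0; apply; split.
  by move=> n; rewrite /harmonic/= invr_gt0.
exact: cvg_harmonic.
Qed.

Lemma measurable_rough_bessel (t : R) : 0 <= t -> measurable_fun setT (X t).
Proof.
move=> t0; apply: measurable_fun_cvg; last first.
  by move=> w _; exact: rough_bessel_cvg_seq.
by move=> n; apply: measurable_Xeps => //; rewrite /harmonic/= invr_gt0.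
Qed.

(** For each regularization the two sides differ by the integral of a nonnegative drift, and the
    inequality passes to the limit: [X - sigma B] is nondecreasing. *)
Lemma rough_bessel_incr (s t : R) w : 0 <= s -> s <= t ->
  sigma * (B t w - B s w) <= X t w - X s w.
Proof.
move=> s0 st; have t0 := le_trans s0 st.
apply: (cvgr_to_ge (cvgB (@rough_bessel_cvg_seq t w t0) (@rough_bessel_cvg_seq s w s0))).
apply: nearW => n.
have e0 : 0 < @harmonic R n by rewrite /harmonic/= invr_gt0.
have := regularized_incr e0 (hX w e0) s0 st.
rewrite !clampE// => hincr.
change (sigma * (B t w - B s w) <= Xeps (@harmonic R n) t w - Xeps (@harmonic R n) s w).
by rewrite hincr lerDr drift_integral_ge0.
Qed.

End rough_bessel.

(** * Consistency of the estimator *)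

Section l2_sums.
Variable R : rcfType.
Implicit Types (p q u v : R) (x y : nat -> R).

(** Triangle inequality in the plane, the induction step for both norm estimates below.
    Cauchy-Schwarz comes from Lagrange's identity, whose defect is [(p v - q u)^2]. *)
Lemma sqrt_sqrD_le p q u v : 0 <= p -> 0 <= q ->
  Num.sqrt ((p + q) ^+ 2 + (u + v) ^+ 2) <=
  Num.sqrt (p ^+ 2 + u ^+ 2) + Num.sqrt (q ^+ 2 + v ^+ 2).
Proof.
move=> p0 q0; set r := Num.sqrt (p ^+ 2 + _); set s := Num.sqrt (q ^+ 2 + _).
have r0 : 0 <= r by exact: sqrtr_ge0.
have s0 : 0 <= s by exact: sqrtr_ge0.
have rE : r ^+ 2 = p ^+ 2 + u ^+ 2 by rewrite sqr_sqrtr// addr_ge0// sqr_ge0.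
have sE : s ^+ 2 = q ^+ 2 + v ^+ 2 by rewrite sqr_sqrtr// addr_ge0// sqr_ge0.
have h : p * q + u * v <= r * s.
  rewrite (le_trans (ler_norm _))// -ler_sqr ?nnegrE ?mulr_ge0//.
  rewrite -normrX ger0_norm ?sqr_ge0// exprMn rE sE.
  rewrite -subr_ge0 (_ : _ - _ = (p * v - q * u) ^+ 2); last by ring.
  exact: sqr_ge0.
rewrite -(ger0_norm (addr_ge0 r0 s0)) -sqrtr_sqr ler_wsqrtr//.
have -> : (r + s) ^+ 2 = r ^+ 2 + s ^+ 2 + 2 * (r * s) by ring.
rewrite rE sE; lra.
Qed.

Lemma sum_sqr_ge0 x n : 0 <= \sum_(0 <= k < n) x k ^+ 2.
Proof. by rewrite sumr_ge0// => k _; exact: sqr_ge0. Qed.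

Lemma minkowski_l2 x y n :
  Num.sqrt (\sum_(0 <= k < n) (x k + y k) ^+ 2) <=
  Num.sqrt (\sum_(0 <= k < n) x k ^+ 2) + Num.sqrt (\sum_(0 <= k < n) y k ^+ 2).
Proof.
elim: n => [|n ih]; first by rewrite !big_nil !sqrtr0 addr0.
rewrite !big_nat_recr//=.
set A := \sum_(0 <= k < n) x k ^+ 2; set C := \sum_(0 <= k < n) y k ^+ 2.
have A0 : 0 <= A := sum_sqr_ge0 x n.
have C0 : 0 <= C := sum_sqr_ge0 y n.
have := sqrt_sqrD_le (x n) (y n) (sqrtr_ge0 A) (sqrtr_ge0 C).
rewrite !sqr_sqrtr//; apply: le_trans; rewrite ler_wsqrtr// lerD2r.
rewrite -[leLHS]sqr_sqrtr ?(sum_sqr_ge0 (fun k => x k + y k))//.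
by rewrite ler_sqr ?nnegrE ?addr_ge0// ?sqrtr_ge0.
Qed.

Lemma l2_le_l1 x n : (forall k, (k < n)%N -> 0 <= x k) ->
  Num.sqrt (\sum_(0 <= k < n) x k ^+ 2) <= \sum_(0 <= k < n) x k.
Proof.
elim: n => [|n ih] x0; first by rewrite !big_nil sqrtr0.
rewrite !big_nat_recr//=.
set A := \sum_(0 <= k < n) x k ^+ 2.
have A0 : 0 <= A := sum_sqr_ge0 x n.
have := sqrt_sqrD_le 0 (x n) (sqrtr_ge0 A) (lexx 0).
rewrite addr0 add0r !sqr_sqrtr// expr0n/= addr0 add0r sqrtr_sqr.
move=> /le_trans; apply; rewrite ger0_norm ?x0// lerD2r.
by apply: ih => k kn; apply: x0; exact: ltnW.
Qed.

(** Reverse triangle inequality, then l2 below l1. For nonnegative differences the l1 norm is a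
    plain sum, which telescopes when they are increments of a monotone path. *)
Lemma dist_l2_le (x y : nat -> R) n : (forall k, (k < n)%N -> y k <= x k) ->
  `|Num.sqrt (\sum_(0 <= k < n) x k ^+ 2) - Num.sqrt (\sum_(0 <= k < n) y k ^+ 2)|
   <= \sum_(0 <= k < n) (x k - y k).
Proof.
move=> yx.
have h1 := minkowski_l2 y (fun k => x k - y k) n.
have h2 := minkowski_l2 x (fun k => y k - x k) n.
have h4 : Num.sqrt (\sum_(0 <= k < n) (x k - y k) ^+ 2) <= \sum_(0 <= k < n) (x k - y k).
  by apply: l2_le_l1 => k kn; rewrite subr_ge0 yx.
have e1 : \sum_(0 <= k < n) (y k + (x k - y k)) ^+ 2 = \sum_(0 <= k < n) x k ^+ 2.
  by apply: eq_bigr => k _; rewrite addrC subrK.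
have e2 : \sum_(0 <= k < n) (x k + (y k - x k)) ^+ 2 = \sum_(0 <= k < n) y k ^+ 2.
  by apply: eq_bigr => k _; rewrite addrC subrK.
have e3 : \sum_(0 <= k < n) (y k - x k) ^+ 2 = \sum_(0 <= k < n) (x k - y k) ^+ 2.
  by apply: eq_bigr => k _; ring.
rewrite e1 in h1; rewrite e2 e3 in h2.
by rewrite ler_norml; apply/andP; split; lra.
Qed.

(** Multiply by the conjugate [sqrt z + c >= c]. This carries errors of the quadratic variation over
    to its square root. *)
Lemma dist_sqrt_le (z c : R) : 0 <= z -> 0 < c ->
  `|Num.sqrt z - c| <= `|z - c ^+ 2| / c.
Proof.
move=> z0 c0; rewrite ler_pdivlMr//.
have s0 := sqrtr_ge0 z.
rewrite -[z in leRHS]sqr_sqrtr// subr_sqr normrM ler_wpM2l//.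
by rewrite ger0_norm ?lerDr// addr_ge0// ltW.
Qed.
End l2_sums.

(** * Tail bounds *)

Section convergence_in_probability.
Variables (R : realType) (d : measure_display) (Omega : measurableType d).
Variable P : probability Omega R.

Lemma chebyshev_second_moment (f : Omega -> R) (K eta : R) :
  measurable_fun setT f -> 0 < eta -> rintegrable P (fun w => f w ^+ 2) ->
  \int[P]_w (f w ^+ 2) <= K ->
  (P [set w | (eta <= `|f w|)%R] <= (K / eta ^+ 2)%:E)%E.
Proof.
move=> mf eta0 If fK.
pose Y : {RV P >-> R} := HB.pack f (isMeasurableFun.Build _ _ _ _ _ mf).
have e2 : 0 < eta ^+ 2 by exact: exprn_gt0.
have h : ((eta ^+ 2)%:E * P [set w | (eta%:E <= `|(Y w)%:E|)%E] <=
    'E_P[((fun x : R => x ^+ 2) \o (fun x : R => `|x|) \o Y)%R])%E.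
  apply: (@markov _ _ _ P Y (fun x : R => x ^+ 2)) => //.
  - by move=> r _; exact: sqr_ge0.
  - by move=> x y; rewrite !nnegrE => ? ?; rewrite ler_sqr.
have E : ('E_P[((fun x : R => x ^+ 2) \o (fun x : R => `|x|) \o Y)%R] <= K%:E)%E.
  rewrite unlock (_ : (\int[P]_w _)%E = (\int[P]_w (f w ^+ 2)%:E)%E).
    by rewrite EFin_Rintegral// lee_fin.
  by apply: eq_integral => w _; rewrite /= real_normK// num_real.
rewrite EFinM lee_pdivlMr// muleC.
exact: le_trans h E.
Qed.

(** A single real random variable is tight: choose [M] with [P (A > M)] small; once [c n < eta / M]
    the event is contained in [A > M]. *)
Lemma cvg_scaled_tail (A : Omega -> R) (c : R^nat) (eta : R) :
  measurable_fun setT A -> 0 < eta -> (forall n, 0 <= c n) ->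
  c n @[n --> \oo] --> 0 ->
  P [set w | eta <= c n * A w] @[n --> \oo] --> 0%E.
Proof.
move=> mA eta0 c0 cc.
pose Y : {RV P >-> R} := HB.pack A (isMeasurableFun.Build _ _ _ _ _ mA).
have mS n : measurable [set w | eta <= c n * A w].
  rewrite -[X in measurable X]setTI; apply: measurable_fun_le => //.
  exact: measurable_funM.
have mT (M : R) : measurable [set w | M < A w].
  rewrite (_ : [set w | _] = ~` [set w | A w <= M]); last first.
    by apply/seteqP; split => w /=; rewrite ltNge => /negP.
  by apply: measurableC; rewrite -[X in measurable X]setTI; exact: measurable_fun_le.
have tail : forall eps : R, 0 < eps ->
    exists2 M : R, 0 < M & (P [set w | (M < A w)%R] <= eps%:E)%E.
  move=> eps eps0; have := cvg_ccdfy0 Y.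
  move=> /fine_cvgP[_ /cvgr0Pnorm_le/(_ _ eps0)][M0 [_ hM]].
  pose M := Num.max M0 0 + 1.
  exists M; first by rewrite ltr_wpDl// le_max lexx orbT.
  have := hM M; rewrite /M /= ltr_pwDr// ?le_max ?lexx// => /(_ isT).
  rewrite ger0_norm; last exact: fine_ge0.
  rewrite -lee_fin fineK; last exact: fin_num_measure.
  apply: le_trans; rewrite /ccdf /distribution /pushforward /=.
  rewrite (_ : A @^-1` _ = [set w | M < A w])//.
  by apply/seteqP; split => w /=; rewrite in_itv/= andbT.
apply/fine_cvgP; split.
  by apply: nearW => n; exact: fin_num_measure.
apply/cvgr0Pnorm_le => eps eps0.
have [M M0 hM] := tail _ eps0.
near=> n.
have cn : c n < eta / M.
  rewrite -(ger0_norm (c0 n)); near: n.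
  by move/cvgr0Pnorm_lt : cc; apply; exact: divr_gt0.
rewrite /= ger0_norm; last exact: fine_ge0.
rewrite -lee_fin fineK; last exact: fin_num_measure.
apply: le_trans hM; apply: le_measure; rewrite ?inE// => w /= hw.
rewrite ltNge; apply/negP => AM.
have : c n * A w <= c n * M by rewrite ler_wpM2l.
move/(le_trans hw); rewrite leNgt => /negP; apply.
by rewrite -ltr_pdivlMr.
Unshelve. all: by end_near. Qed.

End convergence_in_probability.

(** * Drift and noise parts of the estimation error *)

Section estimator.
Variables (R : realType) (d : measure_display) (Omega : measurableType d).
Variables (P : probability Omega R) (H x0 a sigma T : R).
Hypotheses (hH : 0 < H < 2^-1) (hx0 : 0 < x0) (ha : 0 < a) (hsigma : 0 < sigma).
Hypothesis hT : 0 < T.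
Variables (B : R -> {RV P >-> R}) (Xeps : R -> R -> Omega -> R).
Hypothesis hB : fractional_brownian_motion H B.
Hypothesis hX : forall (e : R) (w : Omega), 0 < e ->
  regularized_solution x0 a sigma e (fun t => B t w) (fun t => Xeps e t w).
Local Notation X := (rough_bessel Xeps).
Local Notation p := (2 * H).
Local Notation q n := (n%:R `^ (- 1 + p)).
Local Notation tt n k := (k%:R * T / n%:R).
Local Notation incr2 n w := (\sum_(0 <= k < n) (fbm_incr B T n k w ^+ 2 - (T / n%:R) `^ p)).

Let H0 : 0 < H. Proof. by case/andP: hH. Qed.

Let tt0 n k : 0 <= tt n k.
Proof. by rewrite divr_ge0// mulr_ge0// ltW. Qed.

Let TH0 : 0 < T `^ H. Proof. exact: powR_gt0. Qed.

Let mX t : 0 <= t -> measurable_fun setT (X t).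
Proof. by move=> t0; exact: (measurable_rough_bessel H0 hx0 ha hsigma hB hX t0). Qed.

Lemma measurable_sigma_hat n : measurable_fun setT (sigma_hat H T X n).
Proof.
apply: measurable_funM => //.
apply: (@measurableT_comp _ _ _ _ _ _ (@Num.sqrt R)).
  by apply: continuous_measurable_fun; exact: sqrt_continuous.
apply: measurable_funM => //.
apply: measurable_sum => k; apply: measurable_funX.
by apply: measurable_funB; exact: mX.
Qed.

(** The drift accumulated over [[0, T]], expressed through [X] and [B] so that its measurability is
    inherited. *)
Definition total_drift w : R := (X T w - X 0 w) - sigma * (B T w - B 0 w).

Lemma measurable_total_drift : measurable_fun setT total_drift.
Proof.
apply: measurable_funB; first by apply: measurable_funB; apply: mX => //; exact: ltW.
by apply: measurable_funM => //; exact: measurable_funB.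
Qed.

Lemma dist_quadratic_variation n w : (0 < n)%N ->
  `|Num.sqrt (quadratic_variation T n (X ^~ w)) -
    sigma * Num.sqrt (\sum_(0 <= k < n) fbm_incr B T n k w ^+ 2)| <= total_drift w.
Proof.
move=> n0.
have -> : sigma * Num.sqrt (\sum_(0 <= k < n) fbm_incr B T n k w ^+ 2) =
    Num.sqrt (\sum_(0 <= k < n) (sigma * fbm_incr B T n k w) ^+ 2).
  under [in RHS]eq_bigr do rewrite exprMn.
  by rewrite -mulr_sumr sqrtrM ?sqr_ge0// sqrtr_sqr gtr0_norm.
pose x k := X (tt n k.+1) w - X (tt n k) w.
apply: le_trans (dist_l2_le (x := x) _) _ => [k kn|].
  apply: (rough_bessel_incr H0 hx0 ha hsigma hB hX) => //.
  by rewrite -!mulrA ler_wpM2r ?ler_nat// divr_ge0// ltW.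
(* The differences are increments of the nondecreasing [X - sigma B], so their sum telescopes to a
   bound that does not depend on [n]. *)
pose u k := X (tt n k) w - sigma * B (tt n k) w.
rewrite (eq_bigr (fun k => u k.+1 - u k)); last first.
  by move=> k _; rewrite /u /x /fbm_incr; ring.
rewrite telescope_sumr// /u mul0r mul0r mulrC mulrA mulVf ?mul1r; last first.
  by rewrite pnatr_eq0 -lt0n.
by rewrite /total_drift; lra.
Qed.

Let qnh n : (0 < n)%N -> q n * n%:R * (T / n%:R) `^ p = T `^ p.
Proof.
move=> n0; have nn : (0 : R) < n%:R by rewrite ltr0n.
rewrite powRD; last by apply/implyP => _; rewrite gt_eqF.
rewrite powR_inv1 ?ltW// powRM ?invr_ge0 ?ltW//.
have -> : n%:R^-1 `^ p = (n%:R `^ p)^-1 :> R.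
  by rewrite -powR_inv1 ?ltW// -powRrM mulN1r powRN.
by field; rewrite !gt_eqF// powR_gt0.
Qed.

(** One inverse power of [T^H] is the normalization of the estimator, the other comes from
    [dist_sqrt_le] at [c = T^H]. *)
Definition noise_error n w : R := sigma * (T `^ H) ^- 2 * q n * incr2 n w.

Lemma sigma_hat_error n w : (0 < n)%N ->
  `|sigma_hat H T X n w - sigma| <=
  (T `^ H)^-1 * Num.sqrt (q n) * total_drift w + `|noise_error n w|.
Proof.
move=> n0; set V := \sum_(0 <= k < n) fbm_incr B T n k w ^+ 2.
have V0 : 0 <= V by apply: sum_sqr_ge0.
have q0 : 0 <= q n by exact: powR_ge0.
have hq : q n * V - (T `^ H) ^+ 2 = q n * incr2 n w.
  have -> : incr2 n w = V - n%:R * (T / n%:R) `^ p.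
    by rewrite sumrB sumr_const_nat subn0 (mulr_natl _ n).
  rewrite mulrBr mulrA qnh//.
  by rewrite -powR_mulrn ?powR_ge0// -powRrM (mulrC H).
(* Insert the square root of the quadratic variation of [sigma B]: the first term isolates the
   drift, the second the noise. *)
have -> : sigma_hat H T X n w - sigma = (T `^ H)^-1 *
   (Num.sqrt (q n) * (Num.sqrt (quadratic_variation T n (X ^~ w)) - sigma * Num.sqrt V) +
    sigma * (Num.sqrt (q n * V) - T `^ H)).
  rewrite /sigma_hat !sqrtrM//; field.
  by rewrite gt_eqF.
rewrite normrM gtr0_norm ?invr_gt0// -[X in _ <= X + _]mulrA.
have -> : `|noise_error n w| =
    (T `^ H)^-1 * (sigma * (`|q n * V - (T `^ H) ^+ 2| / T `^ H)).
  rewrite hq /noise_error -[X in `|X|]mulrA normrM gtr0_norm; last first.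
    by rewrite mulr_gt0// invr_gt0 exprn_gt0.
  by field; rewrite gt_eqF.
rewrite -mulrDr ler_wpM2l ?invr_ge0 ?(ltW TH0)//.
apply: le_trans (ler_normD _ _) _; apply: lerD.
  rewrite normrM ger0_norm ?sqrtr_ge0// ler_wpM2l ?sqrtr_ge0//.
  exact: dist_quadratic_variation.
rewrite normrM gtr0_norm// ler_wpM2l ?(ltW hsigma)//.
by apply: dist_sqrt_le => //; exact: mulr_ge0.
Qed.

(** By [qnh] the scaled bound is [4 (T^p)^2 / n] up to constants. The quotient of [T^p] by [(T^H)^2]
    equals 1 and is left unsimplified. *)
Lemma noise_error_moment n : (0 < n)%N ->
  rintegrable P (fun w => noise_error n w ^+ 2) /\
  \int[P]_w (noise_error n w ^+ 2) <= 4 * (sigma * T `^ p / (T `^ H) ^+ 2) ^+ 2 / n%:R.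
Proof.
move=> n0; have [i1 E1] := fbm_quadratic_variation_error hH hB hT n0.
have eqf : (fun w => noise_error n w ^+ 2) =
    (fun w => (sigma * (T `^ H) ^- 2 * q n) ^+ 2 * (incr2 n w) ^+ 2).
  by apply/funext => w; rewrite /noise_error exprMn.
rewrite eqf; split; first exact: rintegrableZ.
rewrite RintegralZl//.
apply: le_trans (ler_wpM2l (sqr_ge0 _) E1) _.
have nn : (n%:R : R) != 0 by rewrite pnatr_eq0 -lt0n.
rewrite -(qnh n0) le_eqVlt; apply/orP; left; apply/eqP.
by field; rewrite nn gt_eqF.
Qed.

End estimator.

Theorem theorem3p6 (R : realType) (d : measure_display)
    (Omega : measurableType d) (P : probability Omega R)
    (H x0 a sigma T : R)
    (hH : 0 < H < 2^-1) (hx0 : 0 < x0) (ha : 0 < a) (hsigma : 0 < sigma)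
    (hT : 0 < T)
    (B : R -> {RV P >-> R}) (hB : fractional_brownian_motion H B)
    (Xeps : R -> R -> Omega -> R)
    (hX : forall (e : R) (w : Omega), 0 < e ->
      regularized_solution x0 a sigma e (fun t => B t w)
        (fun t => Xeps e t w)) :
  cvg_in_probability P (sigma_hat H T (rough_bessel Xeps)) (cst sigma).
Proof.
have H0 : 0 < H by case/andP: hH.
have cinv : (n%:R : R)^-1 @[n --> \oo] --> 0.
  by rewrite -(cvg_shiftS (fun n => (n%:R : R)^-1)); exact: cvg_harmonic.
split.
- by move=> n; exact: (measurable_sigma_hat hH hx0 ha hsigma hT hB hX).
- exact: measurable_cst.
move=> delta delta0.
pose c (n : nat) : R := (T `^ H)^-1 * Num.sqrt (n%:R `^ (- 1 + 2 * H)).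
have c0 n : 0 <= c n by rewrite mulr_ge0 ?sqrtr_ge0// invr_ge0 powR_ge0.
have cc : c n @[n --> \oo] --> 0.
  rewrite -[0](mulr0 (T `^ H)^-1); apply: cvgMr.
  (* Here [H < 1/2] makes the exponent [1 - 2H] of [1 / n] positive. *)
  rewrite (_ : (fun n => _) = (fun n => (n%:R^-1 `^ (1 - 2 * H)) `^ 2^-1)); last first.
    apply/funext => n; rewrite powR12_sqrt ?powR_ge0//; congr Num.sqrt.
    by rewrite -powR_inv1// -powRrM; congr (_ `^ _); ring.
  apply: cvg_powR0 => [//|n|]; first exact: powR_ge0.
  by apply: cvg_powR0 => // ; case/andP: hH => _ ?; lra.
pose D := total_drift sigma T B Xeps.
have mD : measurable_fun setT D := measurable_total_drift hH hx0 ha hsigma hT hB hX.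
have d2 : 0 < delta / 2 by rewrite divr_gt0.
pose K := 4 * (sigma * T `^ (2 * H) / (T `^ H) ^+ 2) ^+ 2 / (delta / 2) ^+ 2.
have mN n : measurable_fun setT (noise_error H sigma T B n).
  apply: measurable_funM => //; apply: measurable_sum => k.
  apply: measurable_funB => //; apply: measurable_funX.
  exact: measurable_funB.
(* Half of [delta] is allotted to the drift, controlled by tightness, and half to the noise,
   controlled by Chebyshev. *)
apply: (@squeeze_cvge _ _ _ _ (cst 0%E) _
  (fun n => P [set w | (delta / 2 <= c n * D w)%R] + (K * n%:R^-1)%:E)%E).
- near=> n; rewrite measure_ge0/=.
  have n0 : (0 < n)%N by near: n; exact: nbhs_infty_gt.
  have [iN EN] := noise_error_moment sigma hH hT hB n0.
  have hP := chebyshev_second_moment (mN n) d2 iN EN.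
  have m1 : measurable [set w | delta / 2 <= c n * D w].
    rewrite -[X in measurable X]setTI; apply: measurable_fun_le => //.
    exact: measurable_funM.
  have m2 : measurable [set w | delta / 2 <= `|noise_error H sigma T B n w|].
    rewrite -[X in measurable X]setTI; apply: measurable_fun_le => //.
    exact: measurableT_comp.
  apply: (@le_trans _ _ (P ([set w | (delta / 2 <= c n * D w)%R] `|`
    [set w | (delta / 2 <= `|noise_error H sigma T B n w|)%R]))).
    apply: le_measure; rewrite ?inE.
    + rewrite -[X in measurable X]setTI; apply: measurable_fun_le => //.
      apply: measurableT_comp => //; apply: measurable_funB => //.
      exact: (measurable_sigma_hat hH hx0 ha hsigma hT hB hX).
    + exact: measurableU.
    + move=> w /= hw; have := sigma_hat_error hH hx0 ha hsigma hT hB hX w n0.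
      rewrite -/(c n) -/(D w) => hle.
      (* If the drift term stays below [delta / 2], the noise term must exceed it. *)
      have [h1|h1] := leP (delta / 2) (c n * D w); [by left|right].
      have : delta <= c n * D w + `|noise_error H sigma T B n w| := le_trans hw hle.
      by lra.
  apply: (le_trans (measureU2 _ m1 m2)); apply: leeD => //.
  apply: (le_trans hP); rewrite lee_fin /K.
  by rewrite mulrAC.
- exact: cvg_cst.
- rewrite -[0%E]adde0; apply: cvgeD => //.
    exact: cvg_scaled_tail.
  apply: cvg_EFin; first exact: nearW.
  by rewrite -[0](mulr0 K); exact: cvgMr.
Unshelve. all: by end_near. Qed.
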